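(* Let $A$ be a graded monoid with $A_0=\{0,1\}$ which is finitely generated by $A_1$ over $A_0$, and let $\mathcal{F}$ be a coherent sheaf on $X=\operatorname{MProj}(A)$. Then $\Gamma(X,\mathcal{F})$ is a finite pointed set.
   Context: A monoid is a commutative associative monoid with identity $1$ and absorbing element $0$. An $A$-module is a pointed set $(M,* )$ with an action of $A$ such that $1m=m$, $a(bm)=(ab)m$, $0m=*$; it is finitely generated if there are $m_1,\dots,m_k\in M$ such that every element is of the form $am_i$. A graded monoid is $A=\bigoplus_{i\ge0}A_i$ (wedge sum of pointed subsets) with $A_iA_j\subset A_{i+j}$; $A_{(f)}$ is the degree-$0$ part of the localization $A_f$ at $\{1,f,f^2,\dots\}$. ''Finitely generated by $A_1$ over $A_0$'' means $A_1$ is finite and every element of $A$ is an element of $A_0$ times a product of elements of $A_1$. $X=\operatorname{MProj}(A)$ is the set of prime ideals not containing $A_{\ge1}$ with the Zariski topology, covered by $D_+(f)\cong\operatorname{MSpec}(A_{(f)})$, $f\in A_1$, with structure sheaf $\mathcal O_X|_{D_+(f)}\cong\widetilde{A_{(f)}}$. A sheaf of pointed sets with $\mathcal O_X$-action is coherent if it is locally isomorphic to $\widetilde{N}$ (the sheaf with sections $N_g$ on basic opens $D(g)$) for a finitely generated module $N$ over the affine coordinate monoid. *)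

(* Defs.v *)
From Stdlib Require Import List Arith.
Import ListNotations.
Set Implicit Arguments.
Unset Strict Implicit.

Record Monoid := {
  mcar :> Type;
  mmul : mcar -> mcar -> mcar;
  mone : mcar;
  mzero : mcar;
  mmulC : forall a b, mmul a b = mmul b a;
  mmulA : forall a b c, mmul a (mmul b c) = mmul (mmul a b) c;
  mmul1 : forall a, mmul mone a = a;
  mmul0 : forall a, mmul mzero a = mzero }.

Arguments mmul m : clear implicits.

Fixpoint mpow (A : Monoid) (a : A) (k : nat) : A :=
  match k with 0 => mone A | S k => mmul A a (mpow a k) end.

Record Grading (A : Monoid) := {
  part : nat -> A -> Prop;
  part_zero : forall i, part i (mzero A);
  part_cover : forall a, exists i, part i a;
  part_disj : forall i j a, part i a -> part j a -> i <> j -> a = mzero A;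
  part_mul : forall i j a b, part i a -> part j b -> part (i + j) (mmul A a b) }.

Definition A0_is_01 (A : Monoid) (G : Grading A) : Prop :=
  forall a, part G 0 a -> a = mzero A \/ a = mone A.

Definition fin_gen_by_A1 (A : Monoid) (G : Grading A) : Prop :=
  (exists l : list A, forall a, part G 1 a -> In a l) /\
  (forall a : A, exists (b : A) (l : list A),
      part G 0 b /\ Forall (part G 1) l /\ a = mmul A b (fold_right (mmul A) (mone A) l)).

Definition is_prime (A : Monoid) (p : A -> Prop) : Prop :=
  p (mzero A) /\ ~ p (mone A) /\
  (forall a b, p a -> p (mmul A b a)) /\
  (forall a b, p (mmul A a b) -> p a \/ p b).

Definition is_mproj_point (A : Monoid) (G : Grading A) (p : A -> Prop) : Prop :=
  is_prime p /\ exists (i : nat) (a : A), 1 <= i /\ part G i a /\ ~ p a.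

Definition MProj (A : Monoid) (G : Grading A) := { p : A -> Prop | is_mproj_point G p }.

Definition pid (A : Monoid) (G : Grading A) (x : MProj G) : A -> Prop := proj1_sig x.

Record opens (A : Monoid) (G : Grading A) := {
  oset : MProj G -> Prop;
  oopen : forall x, oset x ->
     exists f : A, ~ pid x f /\ forall y, ~ pid y f -> oset y }.

Definition incl (A : Monoid) (G : Grading A) (V U : opens G) : Prop :=
  forall x, oset V x -> oset U x.

Lemma top_open_proof (A : Monoid) (G : Grading A) :
  forall x : MProj G, True -> exists f : A, ~ pid x f /\ forall y : MProj G, ~ pid y f -> True.
Proof.
  intros x _. destruct (proj2_sig x) as [_ [i [a [_ [_ Ha]]]]].
  exists a. split; [exact Ha | auto].
Qed.

Definition topen (A : Monoid) (G : Grading A) : opens G :=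
  {| oset := fun _ => True; oopen := @top_open_proof A G |}.

Lemma W_open_proof (A : Monoid) (G : Grading A) (h a : A) :
  forall x : MProj G, (~ pid x h /\ ~ pid x a) ->
    exists f : A, ~ pid x f /\ forall y : MProj G, ~ pid y f -> (~ pid y h /\ ~ pid y a).
Proof.
  intros x [Hh Ha]. exists (mmul A h a). split.
  - destruct (proj2_sig x) as [[_ [_ [_ Hpr]]] _]. unfold pid in *.
    intros H. destruct (Hpr _ _ H); auto.
  - intros y Hq. destruct (proj2_sig y) as [[_ [_ [Hid _]]] _]. unfold pid in *. split.
    + intros H. apply Hq. rewrite mmulC. apply Hid. exact H.
    + intros H. apply Hq. apply Hid. exact H.
Qed.

Definition W (A : Monoid) (G : Grading A) (h a : A) : opens G :=
  {| oset := fun x => ~ pid x h /\ ~ pid x a; oopen := @W_open_proof A G h a |}.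

(* ---------- Sections of O_X as homogeneous degree-0 fractions b/t ---------- *)
Definition denom (A : Monoid) (G : Grading A) (U : opens G) (t : A) : Prop :=
  forall x, oset U x -> ~ pid x t.

Definition frac (A : Monoid) (G : Grading A) (U : opens G) (b t : A) : Prop :=
  denom U t /\ exists i, part G i b /\ part G i t.

Definition feq (A : Monoid) (G : Grading A) (U : opens G) (b t b' t' : A) : Prop :=
  exists u, denom U u /\ mmul A u (mmul A b t') = mmul A u (mmul A b' t).

Record OSheaf (A : Monoid) (G : Grading A) := {
  sec : opens G -> Type;
  spt : forall U, sec U;
  res : forall U V : opens G, incl V U -> sec U -> sec V;
  res_id : forall U (H : incl U U) s, res H s = s;
  res_comp : forall U V Wo (H1 : incl V U) (H2 : incl Wo V) (H3 : incl Wo U) s,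
      res H2 (res H1 s) = res H3 s;
  res_pt : forall U V (H : incl V U), res H (spt U) = spt V;
  sh_locality : forall (U : opens G) (I : Type) (C : I -> opens G)
      (HC : forall i, incl (C i) U),
      (forall x, oset U x -> exists i, oset (C i) x) ->
      forall s t, (forall i, res (HC i) s = res (HC i) t) -> s = t;
  sh_gluing : forall (U : opens G) (I : Type) (C : I -> opens G)
      (HC : forall i, incl (C i) U),
      (forall x, oset U x -> exists i, oset (C i) x) ->
      forall s : forall i, sec (C i),
      (forall i j (V : opens G) (Hi : incl V (C i)) (Hj : incl V (C j)),
          res Hi (s i) = res Hj (s j)) ->
      exists t, forall i, res (HC i) t = s i;
  (* action of the section b/t of O_X on F(U) *)
  act : forall U, A -> A -> sec U -> sec U;
  act_wd : forall U b t b' t' s, frac U b t -> frac U b' t' -> feq U b t b' t' ->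
      @act U b t s = @act U b' t' s;
  act_one : forall U s, @act U (mone A) (mone A) s = s;
  act_mul : forall U b t b' t' s, frac U b t -> frac U b' t' ->
      @act U b t (@act U b' t' s) = @act U (mmul A b b') (mmul A t t') s;
  act_zero : forall U t s, frac U (mzero A) t -> @act U (mzero A) t s = spt U;
  act_res : forall U V (H : incl V U) b t s, frac U b t ->
      res H (@act U b t s) = @act V b t (res H s) }.

Arguments sec {A G} F U : rename.
Arguments spt {A G} F U : rename.
Arguments res {A G} F {U V} H s : rename.
Arguments act {A G} F U b t s : rename.

(* ---------- Modules over A_(h) (h ∈ A_d): nact c m y = (c / h^m) · y ---------- *)
Definition hloc_eq (A : Monoid) (h c : A) (m : nat) (c' : A) (m' : nat) : Prop :=
  exists k, mmul A (mpow h k) (mmul A c (mpow h m'))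
          = mmul A (mpow h k) (mmul A c' (mpow h m)).

Record HMod (A : Monoid) (G : Grading A) (h : A) (d : nat) := {
  ncar : Type;
  npt : ncar;
  nact : A -> nat -> ncar -> ncar;
  nact_wd : forall c m c' m' y, part G (m * d) c -> part G (m' * d) c' ->
      hloc_eq h c m c' m' -> nact c m y = nact c' m' y;
  nact_one : forall y, nact (mone A) 0 y = y;
  nact_mul : forall c m c' m' y, part G (m * d) c -> part G (m' * d) c' ->
      nact c m (nact c' m' y) = nact (mmul A c c') (m + m') y;
  nact_zero : forall m y, nact (mzero A) m y = npt }.

Arguments ncar {A G h d} N : rename.
Arguments npt {A G h d} N : rename.
Arguments nact {A G h d} N c m y : rename.

Definition fin_gen_mod (A : Monoid) (G : Grading A) (h : A) (d : nat) (N : HMod G h d) : Prop :=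
  exists gens : list (ncar N), forall y : ncar N,
    exists (c : A) (m : nat) (g : ncar N), In g gens /\ part G (m * d) c /\ y = nact N c m g.

Arguments fin_gen_mod {A G h d} N : rename.

(* Localization N_g at g = a / h^n (a ∈ A_{n d}); (y, k) stands for y / g^k *)
Definition loc_eq (A : Monoid) (G : Grading A) (h : A) (d : nat) (N : HMod G h d)
    (a : A) (n : nat) (p q : ncar N * nat) : Prop :=
  let (y, k) := p in let (y', k') := q in
  exists j, nact N (mpow a (j + k')) (n * (j + k')) y
          = nact N (mpow a (j + k)) (n * (j + k)) y'.

Arguments loc_eq {A G h d} N a n p q : rename.

(* F restricted to D_+(h) is isomorphic to N~ , where D_+(h) ≅ MSpec A_(h) and the basic
   open D(a/h^n) of MSpec A_(h) corresponds to W h a = D_+(h) ∩ D(a). *)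
Definition tilde_iso (A : Monoid) (G : Grading A) (F : OSheaf G) (h : A) (d : nat)
    (N : HMod G h d) : Prop :=
  exists (th : forall (a : A) (n : nat), sec F (W G h a) -> ncar N * nat)
         (th' : forall (a : A) (n : nat), ncar N * nat -> sec F (W G h a)),
  forall a n, part G (n * d) a ->
    (forall s, th' a n (th a n s) = s) /\
    (forall y, loc_eq N a n (th a n (th' a n y)) y) /\
    (forall y y', loc_eq N a n y y' -> th' a n y = th' a n y') /\
    loc_eq N a n (th a n (spt F (W G h a))) (npt N, 0) /\
    (* compatibility with restriction D(g g') ⊆ D(g), g' = a'/h^n' *)
    (forall a' n' (H : incl (W G h (mmul A a a')) (W G h a)) s, part G (n' * d) a' ->
       loc_eq N (mmul A a a') (n + n')
         (th (mmul A a a') (n + n') (res F H s))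
         (let (y, k) := th a n s in (nact N (mpow a' k) (n' * k) y, k))) /\
    (* compatibility with the action of (c/h^m)/g^i = c h^(n i) / (h^m a^i) *)
    (forall c m i s, part G (m * d) c ->
       loc_eq N a n
         (th a n (act F (W G h a) (mmul A c (mpow h (n * i)))
                                  (mmul A (mpow h m) (mpow a i)) s))
         (let (y, k) := th a n s in (nact N c m y, i + k))).

Definition coherent (A : Monoid) (G : Grading A) (F : OSheaf G) : Prop :=
  forall x : MProj G, exists (h : A) (d : nat),
    1 <= d /\ part G d h /\ ~ pid x h /\
    exists N : HMod G h d, fin_gen_mod N /\ tilde_iso F N.

Definition finite_type (T : Type) : Prop := exists l : list T, forall s : T, In s l.

(* Main.v *)
(** Let [a_0, ..., a_(r-1)] be the degree one generators and, for a nonempty set [J] of indices, let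
    [U_J] be the open set where all [a_j], [j] in [J], are invertible. By descending induction on [J], the
    image of [Gamma(X, F)] in [F(U_J)] is finite. The sections in this image with prescribed restrictions
    to all [U_(J + i)] form a set [S]; its elements become equal after multiplication by a power of any
    [a_i / a_j], [i] outside [J]. Because [F(D_+(a_j))] is finitely generated, each element of [S] is, for
    every [j] in [J], a monomial with nonnegative exponents away from [j] applied to one of finitely many
    sections. A Dickson argument bounds the exponents outside [J], so that [S] falls into finitely many
    orbits of the group of degree zero monomials in the [a_j], [j] in [J]; inside one orbit, the
    representations at all [j] confine the group element to a bounded set modulo the stabilizer, as in
    the proof that [X] is proper: an element which is regular everywhere is integral over the
    homogeneous coordinate monoid. *)
From Stdlib Require Import List Arith ZArith Lia Classical ClassicalEpsilon FunctionalExtensionality.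
Require Import Defs.
Import ListNotations.
Set Implicit Arguments.
Unset Strict Implicit.

(** * Finiteness and Dickson's lemma *)

Definition finite_pred (T : Type) (S : T -> Prop) : Prop :=
  exists l : list T, forall s, S s -> In s l.

Lemma finite_pred_cover (T : Type) (S : T -> Prop) (L : list (T -> Prop)) :
  (forall s, S s -> exists P, In P L /\ P s) ->
  (forall P, In P L -> finite_pred (fun s => S s /\ P s)) ->
  finite_pred S.
Proof.
  revert S. induction L as [|P L IH]; intros S Hc Hf.
  - exists []. intros s Hs. destruct (Hc s Hs) as [P [[] _]].
  - destruct (Hf P (or_introl eq_refl)) as [l1 Hl1].
    destruct (IH (fun s => S s /\ ~ P s)) as [l2 Hl2].
    + intros s [Hs HP]. destruct (Hc s Hs) as [Q [[<-|HQ] HQs]]; [tauto | exists Q; auto].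
    + intros Q HQ. destruct (Hf Q (or_intror HQ)) as [l Hl]. exists l.
      intros s [[Hs _] Hq]. apply Hl. tauto.
    + exists (l1 ++ l2). intros s Hs. apply in_or_app.
      destruct (classic (P s)); [left; apply Hl1 | right; apply Hl2]; tauto.
Qed.

(** Finitely many finite covers have a common refinement with finitely many cells, so only one cell
    at a time, given by a piece [sg i] for each index, remains to be treated. The cells used below
    are cut out by prescribed restrictions or by prescribed exponents. *)
Lemma finite_pred_refine (T : Type) (Q : nat -> (T -> Prop) -> Prop) (idx : list nat) :
  forall S : T -> Prop,
  (forall i, In i idx -> exists L : list (T -> Prop),
      (forall P, In P L -> Q i P) /\ forall s, S s -> exists P, In P L /\ P s) ->
  (forall sg : nat -> T -> Prop, (forall i, In i idx -> Q i (sg i)) ->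
      finite_pred (fun s => S s /\ forall i, In i idx -> sg i s)) ->
  finite_pred S.
Proof.
  induction idx as [|i idx IH]; intros S HL Hf.
  - destruct (Hf (fun _ _ => True)) as [l Hl]; [intros i []|].
    exists l. intros s Hs. apply Hl. split; [exact Hs | intros i []].
  - destruct (HL i (or_introl eq_refl)) as [L [HQ Hc]].
    apply finite_pred_cover with L; [exact Hc|]. intros P HP.
    apply IH.
    + intros i' Hi'. destruct (HL i' (or_intror Hi')) as [L' [HQ' Hc']].
      exists L'. split; [exact HQ'|]. intros s [Hs _]. auto.
    + intros sg Hsg.
      (* The piece [P] overrides [sg i] in case [i] occurs again in the tail of the list. *)
      destruct (Hf (fun i' => if Nat.eq_dec i' i then P else sg i')) as [l Hl].
      * intros i' Hi'. destruct (Nat.eq_dec i' i) as [->|Hn]; [auto|].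
        destruct Hi' as [->|Hi']; [congruence | auto].
      * exists l. intros s [[Hs HPs] Hsgs]. apply Hl. split; [exact Hs|].
        intros i' Hi'. destruct (Nat.eq_dec i' i) as [->|Hn]; [auto|].
        destruct Hi' as [->|Hi']; [congruence | auto].
Qed.

Lemma functional_choice (A B : Type) (R : A -> B -> Prop) :
  (forall a, exists b, R a b) -> exists f, forall a, R a (f a).
Proof.
  intros H. exists (fun a => proj1_sig (constructive_indefinite_description _ (H a))).
  intros a. destruct (constructive_indefinite_description _ (H a)). exact r.
Qed.

Lemma uniform_bound (r : nat) (Q : nat -> nat -> Prop) :
  (forall j k k', k <= k' -> Q j k -> Q j k') ->
  (forall j, j < r -> exists k, Q j k) ->
  exists k, forall j, j < r -> Q j k.
Proof.
  intros Hm. induction r as [|r IH]; intros H.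
  - exists 0. lia.
  - destruct IH as [k Hk]; [auto|]. destruct (H r) as [k' Hk']; [lia|].
    exists (k + k'). intros j Hj. destruct (Nat.eq_dec j r) as [->|Hn].
    + apply Hm with k'; [lia | exact Hk'].
    + apply Hm with k; [lia | apply Hk; lia].
Qed.

(** * Monotone subsequences of natural numbers *)

Definition increasing (f : nat -> nat) : Prop := forall n m, n < m -> f n < f m.

Lemma increasing_step (f : nat -> nat) : (forall n, f n < f (S n)) -> increasing f.
Proof. intros H n m Hnm. induction Hnm; [auto | specialize (H m); lia]. Qed.

Lemma increasing_ge (f : nat -> nat) : increasing f -> forall n, n <= f n.
Proof.
  intros H n. induction n as [|n IH]; [lia|]. specialize (H n (S n)). lia.
Qed.

Lemma subsequence (P : nat -> nat -> Prop) (n0 : nat) :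
  (forall n, exists m, n < m /\ P n m) ->
  exists f, f 0 = n0 /\ increasing f /\ forall n, P (f n) (f (S n)).
Proof.
  intros H. destruct (functional_choice H) as [g Hg].
  exists (fun n => Nat.iter n g n0). split; [reflexivity|]. split.
  - apply increasing_step. intros n. apply (Hg (Nat.iter n g n0)).
  - intros n. apply (Hg (Nat.iter n g n0)).
Qed.

(** Either some value recurs infinitely often, or every value is eventually exceeded and [f] tends
    to infinity. *)
Lemma constant_or_increasing (f : nat -> nat) :
  exists g, increasing g /\
    ((forall n, f (g n) = f (g 0)) \/ increasing (fun n => f (g n))).
Proof.
  destruct (classic (exists v, forall N, exists n, N < n /\ f n = v)) as [[v Hv]|Hno].
  - destruct (Hv 0) as [n0 [_ Hn0]].
    destruct (@subsequence (fun n m => f m = v) n0) as [g [H0 [Hi Hg]]]; [auto|].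
    exists g. split; [exact Hi|]. left.
    assert (E : forall n, f (g n) = v) by (intros [|n]; [congruence | apply Hg]).
    intros n. rewrite !E. reflexivity.
  - assert (Hlarge : forall v, exists N, forall n, N < n -> v < f n).
    { intros v. induction v as [|v [N HN]].
      - destruct (classic (exists N, forall n, N < n -> f n <> 0)) as [[N HN]|H].
        + exists N. intros n Hn. specialize (HN n Hn). lia.
        + exfalso. apply Hno. exists 0. intros N. apply NNPP. intros H'. apply H.
          exists N. intros n Hn E. apply H'. exists n. auto.
      - destruct (classic (exists N, forall n, N < n -> f n <> S v)) as [[N' HN']|H].
        + exists (N + N'). intros n Hn.
          specialize (HN n ltac:(lia)). specialize (HN' n ltac:(lia)). lia.
        + exfalso. apply Hno. exists (S v). intros N0. apply NNPP. intros H'. apply H.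
          exists N0. intros n Hn E. apply H'. exists n. auto. }
    destruct (@subsequence (fun n m => f n < f m) 0) as [g [_ [Hi Hg]]].
    + intros n. destruct (Hlarge (f n)) as [N HN]. exists (S (n + N)).
      split; [lia | apply HN; lia].
    + exists g. split; [exact Hi|]. right. apply increasing_step. exact Hg.
Qed.

(** Subsequences are extracted one coordinate at a time, since both alternatives survive passing to
    a further subsequence. Strict growth is what later lets exponents exceed any given bound. *)
Lemma dickson (r : nat) (f : nat -> nat -> nat) :
  exists g, increasing g /\ forall i, i < r ->
    (forall n, f i (g n) = f i (g 0)) \/ increasing (fun n => f i (g n)).
Proof.
  induction r as [|r [g [Hg H]]].
  - exists (fun n => n). split; [intros n m; auto | lia].
  - destruct (constant_or_increasing (fun n => f r (g n))) as [k [Hk Hr]].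
    exists (fun n => g (k n)). split.
    + intros n m Hnm. apply Hg, Hk, Hnm.
    + intros i Hi. destruct (Nat.eq_dec i r) as [->|Hn]; [exact Hr|].
      destruct (H i ltac:(lia)) as [Hc|Hc].
      * left. intros n. rewrite (Hc (k n)), (Hc (k 0)). reflexivity.
      * right. intros n m Hnm. apply Hc, Hk, Hnm.
Qed.

(** * Lattices *)

Open Scope Z_scope.

(** Exponent vectors of Laurent monomials in [r] variables. They are functions on all of [nat];
    vanishing from [r] on is stated separately where it matters, and [vsum r] is the degree. *)
Definition vec := nat -> Z.
Definition vadd (u v : vec) : vec := fun i => u i + v i.
Definition vscale (k : Z) (u : vec) : vec := fun i => k * u i.
Definition vunit (j : nat) : vec := fun i => if Nat.eq_dec i j then 1 else 0.
(** The exponent vector of [a_i / a_j]. *)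
Definition vdiff (i j : nat) : vec := vadd (vunit i) (vscale (-1) (vunit j)).

Fixpoint vsum (r : nat) (u : vec) : Z :=
  match r with O => 0 | S r => vsum r u + u r end.

Ltac vext := apply functional_extensionality; intro; unfold vdiff, vadd, vscale; try lia.

Lemma vsum_zero r : vsum r (fun _ => 0) = 0.
Proof. induction r as [|r IH]; simpl; lia. Qed.

Lemma vsum_add r u v : vsum r (vadd u v) = vsum r u + vsum r v.
Proof. induction r as [|r IH]; simpl; [lia|]. rewrite IH. unfold vadd. lia. Qed.

Lemma vsum_scale r k u : vsum r (vscale k u) = k * vsum r u.
Proof. induction r as [|r IH]; simpl; [lia|]. rewrite IH. unfold vscale. lia. Qed.

Lemma vsum_unit r j : vsum r (vunit j) = if lt_dec j r then 1 else 0.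
Proof.
  induction r as [|r IH]; simpl; [reflexivity|]. rewrite IH. unfold vunit.
  destruct (lt_dec j r), (lt_dec j (S r)), (Nat.eq_dec r j); lia.
Qed.

Lemma vsum_nonneg r u : (forall i, (i < r)%nat -> 0 <= u i) -> 0 <= vsum r u.
Proof.
  induction r as [|r IH]; simpl; intros H; [lia|].
  specialize (IH ltac:(auto)). specialize (H r ltac:(lia)). lia.
Qed.

Lemma le_vsum r u i : (forall i, (i < r)%nat -> 0 <= u i) -> (i < r)%nat -> u i <= vsum r u.
Proof.
  induction r as [|r IH]; simpl; intros H Hi; [lia|].
  pose proof (@vsum_nonneg r u ltac:(auto)). destruct (Nat.eq_dec i r) as [->|Hn]; [lia|].
  specialize (IH ltac:(auto) ltac:(lia)). specialize (H r ltac:(lia)). lia.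
Qed.

Lemma vsum_large r u k : (0 < r)%nat -> (Z.of_nat r) * k <= vsum r u ->
  exists i, (i < r)%nat /\ k <= u i.
Proof.
  induction r as [|r IH]; simpl vsum; intros Hr Hs; [lia|].
  destruct (Z_le_gt_dec k (u r)) as [H|H]; [exists r; lia|].
  destruct r as [|r]; [simpl vsum in Hs; lia|].
  destruct IH as [i [Hi Hk]]; [lia | nia | exists i; split; [lia | exact Hk]].
Qed.

Lemma vec_bounded r (u : vec) : (forall i, (r <= i)%nat -> u i = 0) ->
  exists B, 0 <= B /\ forall i, Z.abs (u i) <= B.
Proof.
  revert u. induction r as [|r IH]; intros u H.
  - exists 0. split; [lia|]. intros i. rewrite H; lia.
  - destruct (IH (fun i => if Nat.eq_dec i r then 0 else u i)) as [B [HB0 HB]].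
    + intros i Hi. destruct (Nat.eq_dec i r); [lia | apply H; lia].
    + exists (B + Z.abs (u r)). split; [lia|]. intros i. specialize (HB i). simpl in HB.
      destruct (Nat.eq_dec i r) as [->|Hn]; lia.
Qed.

Lemma bounded_vectors_finite r B : exists l : list vec, forall v : vec,
  (forall i, (i < r)%nat -> Z.abs (v i) <= B) ->
  exists v', In v' l /\ forall i, (i < r)%nat -> v' i = v i.
Proof.
  induction r as [|r [l Hl]].
  - exists [fun _ => 0]. intros v _. exists (fun _ => 0). split; [simpl; auto | lia].
  - exists (flat_map (fun v' => map (fun k => fun i => if Nat.eq_dec i r then Z.of_nat k - B else v' i)
                         (seq 0 (Z.to_nat (2 * B + 1)))) l).
    intros v Hv. destruct (Hl v) as [v' [Hin Hv']]; [auto|].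
    exists (fun i => if Nat.eq_dec i r then Z.of_nat (Z.to_nat (v r + B)) - B else v' i).
    specialize (Hv r ltac:(lia)). split.
    + apply in_flat_map. exists v'. split; [exact Hin|].
      apply (in_map (fun k => fun i => if Nat.eq_dec i r then Z.of_nat k - B else v' i)).
      apply in_seq. lia.
    + intros i Hi. destruct (Nat.eq_dec i r) as [->|Hn]; [lia | apply Hv'; lia].
Qed.

(** A subgroup [H] of [Z^r] is finitely generated, so dividing the coefficients of [u] by [N] and
    rounding them costs an error linear in [N] and independent of [u]. To avoid bases, the induction
    splits off one element with positive last coordinate. *)
Lemma lattice_rounding r : forall H : vec -> Prop,
  (forall a b u v, H u -> H v -> H (vadd (vscale a u) (vscale b v))) ->
  (forall u, H u -> forall i, (r <= i)%nat -> u i = 0) ->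
  exists B, 0 <= B /\ forall u N, H u -> 0 < N ->
    exists v, H v /\ forall i, Z.abs (u i - N * v i) <= N * B.
Proof.
  induction r as [|r IH]; intros H Hlin Hr.
  - exists 0. split; [lia|]. intros u N Hu HN. exists u. split; [exact Hu|].
    intros i. rewrite (Hr u Hu i); lia.
  - destruct (IH (fun u => H u /\ u r = 0)) as [B [HB0 HB]].
    { intros a b u v [Hu Hur] [Hv Hvr]. split; [auto|]. unfold vadd, vscale. lia. }
    { intros u [Hu Hur] i Hi. destruct (Nat.eq_dec i r) as [->|Hn]; [exact Hur|].
      apply Hr; [exact Hu | lia]. }
    destruct (classic (exists h, H h /\ 0 < h r)) as [[h [Hh Hp]]|Hno].
    + destruct (@vec_bounded (S r) h (Hr h Hh)) as [M [HM0 HM]].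
      exists (B + M). split; [lia|]. intros u N Hu HN.
      (* [h] need not generate the last coordinates of [H]. The combination [p u - e h] has last
         coordinate zero and is rounded with [p N] in place of [N]; for [e = q p N + m] the
         remainder [m h] is at most [p N M], and division by [p] gives the claim. *)
      set (p := h r) in *. set (e := u r).
      destruct (HB (vadd (vscale p u) (vscale (- e) h)) (p * N)) as [v [[Hv Hvr] Hb]].
      { split; [auto|]. unfold vadd, vscale, e, p. lia. }
      { nia. }
      exists (vadd (vscale (e / (p * N)) h) (vscale 1 v)). split; [auto|].
      intros i. specialize (Hb i). specialize (HM i).
      assert (HpN : 0 < p * N) by nia.
      pose proof (Z.div_mod e (p * N) ltac:(lia)) as Hdm.
      pose proof (Z.mod_pos_bound e (p * N) HpN) as Hmb.
      unfold vadd, vscale in *.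
      set (q := e / (p * N)) in *. set (m := e mod (p * N)) in *.
      assert (Hm : Z.abs (m * h i) <= p * N * M) by (rewrite Z.abs_mul; nia).
      assert (E : p * (u i - N * (q * h i + 1 * v i))
                  = (p * u i + - e * h i - p * N * v i) + m * h i) by (rewrite Hdm; ring).
      assert (Hfin : p * Z.abs (u i - N * (q * h i + 1 * v i)) <= p * (N * (B + M))).
      { rewrite <- (Z.abs_eq p) at 1 by lia. rewrite <- Z.abs_mul, E.
        eapply Z.le_trans; [apply Z.abs_triangle|]. nia. }
      apply Z.mul_le_mono_pos_l in Hfin; [exact Hfin | exact Hp].
    + exists B. split; [exact HB0|]. intros u N Hu HN.
      destruct (HB u N) as [v [[Hv _] Hb]]; [split; [exact Hu|] | exact HN | exists v; auto].
      destruct (Z.lt_trichotomy (u r) 0) as [Hl|[Hz|Hg]]; [|exact Hz|].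
      * exfalso. apply Hno. exists (vadd (vscale (-1) u) (vscale 0 u)).
        split; [auto|]. unfold vadd, vscale. lia.
      * exfalso. apply Hno. exists u. auto.
Qed.

Definition supported (r : nat) (J : nat -> bool) (u : vec) : Prop :=
  forall i, (r <= i)%nat \/ J i = false -> u i = 0.

(* If [k e_j + y] is congruent to a nonnegative vector modulo [H] for all [j] in [J], then every
   nonnegative vector of large degree stays so after adding [y], hence [mu + q y] is congruent to some
   [nu_q >= 0] for all [q]. Dickson's lemma gives [q < q'] with [nu_q <= nu_q'], so that a positive
   multiple of [y] is congruent to a nonnegative vector, whose entries are bounded by its degree. *)
Lemma lattice_bounded r J (H : vec -> Prop) C :
  (forall a b u v, H u -> H v -> H (vadd (vscale a u) (vscale b v))) ->
  (forall u, H u -> vsum r u = 0 /\ supported r J u) ->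
  0 <= C -> (exists j, (j < r)%nat /\ J j = true) ->
  exists B, forall w, vsum r w = 0 -> supported r J w ->
    (forall j, (j < r)%nat -> J j = true ->
       exists h, H h /\ forall i, i <> j -> - C <= w i + h i) ->
    exists h, H h /\ forall i, Z.abs (w i + h i) <= B.
Proof.
  intros Hlin HJ HC [j0 [Hj0 HJj0]].
  destruct (@lattice_rounding r H Hlin) as [B [HB0 HB]].
  { intros u Hu i Hi. apply (HJ u Hu). left. exact Hi. }
  (* Adding [C] on the coordinates in [J] turns the lower bound [- C] of the hypothesis into
     nonnegativity of [y + h] away from [j]. *)
  pose (c1 := fun i => if lt_dec i r then if J i then C else 0 else 0).
  assert (Hc1 : forall i, 0 <= c1 i <= C).
  { intros i. unfold c1. destruct (lt_dec i r), (J i); lia. }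
  pose (c := vsum r c1). assert (Hc0 : 0 <= c) by (apply vsum_nonneg; intros; apply Hc1).
  exists (c + B + C). intros w Hw Hsw Hj.
  pose (y := vadd w c1).
  assert (Hsy : supported r J y).
  { intros i Hi. unfold y, vadd. rewrite (Hsw i Hi). unfold c1.
    destruct (lt_dec i r); [|lia]. destruct Hi as [Hi|Hi]; [lia | rewrite Hi; lia]. }
  assert (Hdy : vsum r y = c) by (unfold y; rewrite vsum_add; unfold c; lia).
  (* The entry of [y + h] at [j] itself is not controlled; a large multiple of [e_j] repairs it, and
     one [k0] serves all [j]. *)
  destruct (@uniform_bound r (fun j k => J j = true ->
      exists h, H h /\ forall i, 0 <= Z.of_nat k * vunit j i + y i + h i)) as [k0 Hk0].
  { intros j k k' Hkk HP HJ1. destruct (HP HJ1) as [h [Hh Hhi]]. exists h. split; [exact Hh|].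
    intros i. specialize (Hhi i). unfold vunit in *. destruct (Nat.eq_dec i j); lia. }
  { intros j Hjr. destruct (J j) eqn:EJ; [|exists O; discriminate].
    destruct (Hj j Hjr EJ) as [h [Hh Hhi]].
    exists (Z.to_nat (- (y j + h j))). intros _. exists h. split; [exact Hh|].
    intros i. unfold vunit. destruct (Nat.eq_dec i j) as [->|Hn]; [lia|].
    destruct (HJ h Hh) as [_ Hsh].
    destruct (le_lt_dec r i) as [Hir|Hir].
    { rewrite (Hsy i), (Hsh i) by (left; lia). lia. }
    destruct (J i) eqn:EJi.
    - specialize (Hhi i Hn). unfold y, vadd, c1. rewrite EJi.
      destruct (lt_dec i r); lia.
    - rewrite (Hsy i), (Hsh i) by (right; exact EJi). lia. }
  (* By pigeonhole a vector of degree at least [D = r k] has an entry at least [k]. The summand 1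
     makes [k] positive, so that for a vector supported in [J] the index of this entry lies in
     [J]. *)
  pose (k := Z.of_nat k0 + 1).
  pose (D := Z.of_nat r * k).
  pose (mu := vscale D (vunit j0)).
  assert (Hnu : forall q : nat, exists nu : vec,
      H (vadd nu (vscale (-1) (vadd mu (vscale (Z.of_nat q) y)))) /\
      (forall i, 0 <= nu i) /\ supported r J nu /\ vsum r nu = D + Z.of_nat q * c).
  { intros q. induction q as [|q [nu [Hnu [Hpos [Hsup Hdeg]]]]].
    - exists mu. repeat split.
      + destruct (Hk0 j0 Hj0 HJj0) as [h [Hh _]].
        replace (vadd mu _) with (vadd (vscale 0 h) (vscale 0 h)) by vext. auto.
      + intros i. unfold mu, vscale, vunit, D, k. destruct (Nat.eq_dec i j0); nia.
      + intros i Hi. unfold mu, vscale, vunit. destruct (Nat.eq_dec i j0) as [->|]; [|lia].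
        destruct Hi; [lia | congruence].
      + unfold mu. rewrite vsum_scale, vsum_unit. destruct (lt_dec j0 r); lia.
    - destruct (@vsum_large r nu k) as [i [Hi Hki]]; [lia | unfold D in Hdeg; nia |].
      assert (EJi : J i = true).
      { destruct (J i) eqn:EJi; [reflexivity|]. rewrite (Hsup i) in Hki by auto.
        unfold k in Hki. lia. }
      destruct (Hk0 i Hi EJi) as [h [Hh Hhi]]. destruct (HJ h Hh) as [Hdh Hsh].
      exists (vadd nu (vadd y h)). repeat split.
      + replace (vadd _ _) with
          (vadd (vscale 1 (vadd nu (vscale (-1) (vadd mu (vscale (Z.of_nat q) y))))) (vscale 1 h))
          by vext.
        auto.
      + intros l. specialize (Hhi l). specialize (Hpos l). unfold vadd, vunit in *.
        destruct (Nat.eq_dec l i) as [->|]; unfold k in Hki; lia.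
      + intros l Hl. unfold vadd. rewrite (Hsup l Hl), (Hsy l Hl), (Hsh l Hl). lia.
      + rewrite !vsum_add, Hdeg, Hdy, Hdh. lia. }
  destruct (functional_choice Hnu) as [nu Hnus]. clear Hnu.
  destruct (@dickson r (fun i q => Z.to_nat (nu q i))) as [g [Hg Hgi]].
  pose proof (Hg 0%nat 1%nat ltac:(lia)) as Hlt.
  destruct (Hnus (g 0%nat)) as [Ha [Hap [Has Had]]].
  destruct (Hnus (g 1%nat)) as [Hb [Hbp [Hbs Hbd]]].
  set (q := g 0%nat) in *. set (q' := g 1%nat) in *.
  pose (N := Z.of_nat q' - Z.of_nat q).
  pose (d := vadd (nu q') (vscale (-1) (nu q))).
  assert (Hd0 : forall i, 0 <= d i).
  { intros i. unfold d, vadd, vscale. destruct (le_lt_dec r i) as [Hir|Hir].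
    - rewrite (Has i), (Hbs i) by auto. lia.
    - specialize (Hap i). specialize (Hbp i).
      destruct (Hgi i Hir) as [E|E].
      + specialize (E 1%nat). fold q q' in E. lia.
      + specialize (E 0%nat 1%nat ltac:(lia)). simpl in E. fold q q' in E. lia. }
  assert (Hdd : vsum r d = N * c).
  { unfold d. rewrite vsum_add, vsum_scale, Had, Hbd. unfold N. lia. }
  assert (Hsd : supported r J d).
  { intros i Hi. unfold d, vadd, vscale. rewrite (Has i Hi), (Hbs i Hi). lia. }
  assert (Hdb : forall i, d i <= N * c).
  { intros i. destruct (le_lt_dec r i) as [Hir|Hir].
    - rewrite (Hsd i) by auto. unfold N. nia.
    - rewrite <- Hdd. apply le_vsum; auto. }
  assert (Hh : H (vadd d (vscale (- N) y))).
  { replace (vadd d _) with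
      (vadd (vscale 1 (vadd (nu q') (vscale (-1) (vadd mu (vscale (Z.of_nat q') y)))))
            (vscale (-1) (vadd (nu q) (vscale (-1) (vadd mu (vscale (Z.of_nat q) y)))))); [auto|].
    vext. unfold d, N, vadd, vscale. ring. }
  (* [N y] is congruent to [d], whose entries lie between 0 and [N c]. Rounding [d - N y] to [N h]
     bounds [y + h] by [c + B], and returning from [y] to [w] costs another [C]. *)
  destruct (HB _ N Hh) as [h [Hhh Hhb]]; [unfold N; lia|].
  exists h. split; [exact Hhh|]. intros i.
  specialize (Hhb i). specialize (Hdb i). specialize (Hd0 i). specialize (Hc1 i).
  assert (HN : 0 < N) by (unfold N; lia).
  assert (E : N * (y i + h i) = d i - (d i + - N * y i - N * h i)) by ring.
  unfold vadd, vscale in Hhb.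
  assert (Hyb : N * Z.abs (y i + h i) <= N * (c + B)).
  { rewrite <- (Z.abs_eq N) at 1 by lia. rewrite <- Z.abs_mul, E. lia. }
  apply Z.mul_le_mono_pos_l in Hyb; [|exact HN].
  unfold y, vadd in Hyb. lia.
Qed.

(** * Monomials acting on a set *)

(** Exponents of the degree zero monomials that are functions on [U_J]: only the [a_j] with [j] in
    [J] may occur in the denominator. *)
Definition admissible (r : nat) (J : nat -> bool) (z : vec) : Prop :=
  vsum r z = 0 /\ (forall i, (r <= i)%nat -> z i = 0) /\
  (forall i, (i < r)%nat -> J i = false -> 0 <= z i).

Lemma admissible_add r J u v : admissible r J u -> admissible r J v -> admissible r J (vadd u v).
Proof.
  intros [Hu [Hur Hup]] [Hv [Hvr Hvp]]. repeat split.
  - rewrite vsum_add. lia.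
  - intros i Hi. unfold vadd. rewrite Hur, Hvr by exact Hi. lia.
  - intros i Hi HJ. unfold vadd. specialize (Hup i Hi HJ). specialize (Hvp i Hi HJ). lia.
Qed.

Lemma admissible_scale r J k u : 0 <= k -> admissible r J u -> admissible r J (vscale k u).
Proof.
  intros Hk [Hu [Hur Hup]]. repeat split.
  - rewrite vsum_scale. nia.
  - intros i Hi. unfold vscale. rewrite Hur by exact Hi. lia.
  - intros i Hi HJ. unfold vscale. specialize (Hup i Hi HJ). nia.
Qed.

Lemma admissible_diff r J i j : (i < r)%nat -> (j < r)%nat -> J j = true ->
  admissible r J (vdiff i j).
Proof.
  intros Hi Hj HJ. repeat split.
  - unfold vdiff. rewrite vsum_add, vsum_scale, !vsum_unit.
    destruct (lt_dec i r), (lt_dec j r); lia.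
  - intros l Hl. unfold vdiff, vadd, vscale, vunit.
    destruct (Nat.eq_dec l i), (Nat.eq_dec l j); lia.
  - intros l Hl HJl. unfold vdiff, vadd, vscale, vunit.
    destruct (Nat.eq_dec l j) as [->|]; [congruence|]. destruct (Nat.eq_dec l i); lia.
Qed.

(** Additivity is asked on admissible vectors only, since the other monomials are not functions on
    [U_J]. *)
Record vaction (r : nat) (J : nat -> bool) (T : Type) (za : vec -> T -> T) : Prop := {
  vact0 : forall s, za (fun _ => 0) s = s;
  vactD : forall u v s, admissible r J u -> admissible r J v -> za u (za v s) = za (vadd u v) s }.

(** The shape of a section coming from [D_+(a_j)]: only [a_j] occurs in the denominator, and [m]
    will be one of finitely many generators. *)
Definition represents r (T : Type) (za : vec -> T -> T) (j : nat) (m : T) (z : vec) (s : T) : Prop :=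
  vsum r z = 0 /\ (forall i, (r <= i)%nat -> z i = 0) /\
  (forall i, (i < r)%nat -> i <> j -> 0 <= z i) /\ s = za z m.

Lemma represents_admissible r J (T : Type) (za : vec -> T -> T) j m z s :
  J j = true -> represents r za j m z s -> admissible r J z.
Proof.
  intros HJ [H1 [H2 [H3 _]]]. repeat split; auto.
  intros i Hi HJi. apply H3; [exact Hi | congruence].
Qed.

(* Two sections agreeing off the closed set where [a_i = 0], [i] outside [J], become equal
   after multiplication by a power of [a_i / a_j]. *)
Definition agree_outside r J (T : Type) (za : vec -> T -> T) (s s' : T) : Prop :=
  forall i j, (i < r)%nat -> (j < r)%nat -> J i = false -> J j = true ->
  exists k : nat, za (vscale (Z.of_nat k) (vdiff i j)) s = za (vscale (Z.of_nat k) (vdiff i j)) s'.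

(** As [c] has a positive exponent at [i], for [k >= k0] the vector [k c] is [k0 (e_i - e_j)] plus
    an admissible vector; the exponent at [j] is free because [j] lies in [J]. *)
Lemma agree_outside_multiple r J (T : Type) (za : vec -> T -> T) (s s' : T) i j c :
  vaction r J za -> agree_outside r J za s s' ->
  (i < r)%nat -> (j < r)%nat -> J i = false -> J j = true ->
  admissible r J c -> 0 < c i ->
  exists k0 : nat, forall k : nat, (k0 <= k)%nat ->
    za (vscale (Z.of_nat k) c) s = za (vscale (Z.of_nat k) c) s'.
Proof.
  intros Hza Hag Hi Hj HJi HJj Hc Hci.
  destruct (Hag i j Hi Hj HJi HJj) as [k0 Hk0]. exists k0. intros k Hk.
  assert (Hd : admissible r J (vscale (Z.of_nat k0) (vdiff i j))).
  { apply admissible_scale; [lia|]. apply admissible_diff; auto. }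
  assert (Ha : admissible r J
     (vadd (vscale (Z.of_nat k) c) (vscale (-1) (vscale (Z.of_nat k0) (vdiff i j))))).
  { destruct Hc as [Hc1 [Hc2 Hc3]]. destruct Hd as [Hd1 [Hd2 _]]. repeat split.
    - rewrite vsum_add, !vsum_scale in *. lia.
    - intros l Hl. specialize (Hd2 l Hl). specialize (Hc2 l Hl). unfold vadd, vscale in *. nia.
    - intros l Hl HJl. specialize (Hc3 l Hl HJl). unfold vadd, vscale, vdiff, vadd, vscale, vunit in *.
      destruct (Nat.eq_dec l j) as [->|]; [congruence|].
      destruct (Nat.eq_dec l i) as [->|]; nia. }
  replace (vscale (Z.of_nat k) c) with
    (vadd (vadd (vscale (Z.of_nat k) c) (vscale (-1) (vscale (Z.of_nat k0) (vdiff i j))))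
          (vscale (Z.of_nat k0) (vdiff i j))) by vext.
  rewrite <- (vactD Hza s Ha Hd), <- (vactD Hza s' Ha Hd), Hk0. reflexivity.
Qed.

(* Along a subsequence all exponents outside [J] are constant or strictly increasing. If some exponent
   increases, [s_n = c_n s_0] with [c_n] eventually divisible by every power of [c = c_1]; as
   [c s_0] and [s_0] agree outside, a power of [c] absorbs further factors and [s_n] is constant. *)
Lemma exponents_bounded r J (T : Type) (za : vec -> T -> T) (S : T -> Prop) j m :
  vaction r J za -> (j < r)%nat -> J j = true ->
  (forall s s', S s -> S s' -> agree_outside r J za s s') ->
  exists E : nat, forall s, S s -> (exists z, represents r za j m z s) ->
    exists z, represents r za j m z s /\ forall i, (i < r)%nat -> J i = false -> z i <= Z.of_nat E.
Proof.
  intros Hza Hj HJj Hag. apply NNPP. intros Hno.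
  (* A counterexample for each bound [n]: an element all of whose representations have an exponent
     above [n] outside [J]. *)
  assert (Hseq : forall n : nat, exists p : T * vec, S (fst p) /\ represents r za j m (snd p) (fst p) /\
     forall z, represents r za j m z (fst p) ->
       exists i, (i < r)%nat /\ J i = false /\ Z.of_nat n < z i).
  { intros n. apply NNPP. intros Hn. apply Hno. exists n. intros s Hs [z Hz].
    apply NNPP. intros Hs'. apply Hn. exists (s, z). split; [exact Hs|]. split; [exact Hz|].
    intros z' Hz'. apply NNPP. intros Hz''. apply Hs'. exists z'. split; [exact Hz'|].
    intros i Hi HJi. apply Z.nlt_ge. intros Hlt. apply Hz''. exists i. auto. }
  destruct (functional_choice Hseq) as [p Hp]. clear Hseq Hno.
  destruct (@dickson r (fun i n => Z.to_nat (snd (p n) i))) as [g [Hg Hgi]].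
  pose (s := fun n => fst (p (g n))). pose (z := fun n => snd (p (g n))).
  assert (HS : forall n, S (s n)) by (intros n; apply Hp).
  assert (Hrep : forall n, represents r za j m (z n) (s n)) by (intros n; apply Hp).
  assert (Hunb : forall n z', represents r za j m z' (s n) ->
       exists i, (i < r)%nat /\ J i = false /\ Z.of_nat n < z' i).
  { intros n z' Hz'. destruct (Hp (g n)) as [_ [_ H]]. destruct (H z' Hz') as [i [Hi [HJi Hlt]]].
    exists i. pose proof (increasing_ge Hg n). repeat split; auto; lia. }
  assert (Hadm : forall n, admissible r J (z n)) by (intros n; eapply represents_admissible; eauto).
  assert (Hpos : forall n i, (i < r)%nat -> J i = false -> 0 <= z n i) by (intros n; apply Hadm).
  assert (Hdich : forall i, (i < r)%nat -> J i = false ->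
     (forall n, z n i = z 0%nat i) \/ (forall n n', (n < n')%nat -> z n i < z n' i)).
  { intros i Hi HJi. destruct (Hgi i Hi) as [E|E]; [left | right].
    - intros n. specialize (E n). pose proof (Hpos n i Hi HJi). pose proof (Hpos 0%nat i Hi HJi).
      unfold z in *. lia.
    - intros n n' Hn. specialize (E n n' Hn). pose proof (Hpos n i Hi HJi).
      pose proof (Hpos n' i Hi HJi). unfold z in *. lia. }
  assert (Hmon : forall i n n', (i < r)%nat -> J i = false -> (n <= n')%nat -> z n i <= z n' i).
  { intros i n n' Hi HJi Hn. destruct (Hdich i Hi HJi) as [E|E].
    - rewrite (E n), (E n'). lia.
    - destruct (Nat.eq_dec n n') as [->|]; [lia|]. specialize (E n n'). lia. }
  clearbody s z. clear p Hp g Hg Hgi.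
  pose (c := fun n => vadd (z n) (vscale (-1) (z 0%nat))).
  assert (Hcadm : forall n, admissible r J (c n)).
  { intros n. destruct (Hadm n) as [H1 [H2 _]]. destruct (Hadm 0%nat) as [H3 [H4 _]].
    unfold c. repeat split.
    - rewrite vsum_add, vsum_scale. lia.
    - intros i Hi. unfold vadd, vscale. rewrite H2, H4 by exact Hi. lia.
    - intros i Hi HJi. pose proof (Hmon i 0%nat n Hi HJi ltac:(lia)). unfold vadd, vscale. lia. }
  assert (Hsc : forall n, s n = za (c n) (s 0%nat)).
  { intros n. destruct (Hrep n) as [_ [_ [_ ->]]]. destruct (Hrep 0%nat) as [_ [_ [_ ->]]].
    rewrite (vactD Hza) by auto. f_equal. unfold c. vext. }
  assert (Hconst : exists n0, forall n, (n0 <= n)%nat -> s n = s n0).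
  { destruct (classic (exists i, (i < r)%nat /\ J i = false /\
        forall n n', (n < n')%nat -> z n i < z n' i)) as [[i0 [Hi0 [HJi0 Hinc]]]|Hni].
    - pose (c1 := c 1%nat).
      assert (Hc1i : 0 < c1 i0).
      { pose proof (Hinc 0%nat 1%nat ltac:(lia)). unfold c1, c, vadd, vscale. lia. }
      pose proof (fun s1 s2 H1 H2 => @agree_outside_multiple r J T za s1 s2 i0 j c1 Hza (Hag s1 s2 H1 H2)
        Hi0 Hj HJi0 HJj (Hcadm 1%nat) Hc1i) as Habs.
      destruct (Habs (s 1%nat) (s 0%nat) (HS _) (HS _)) as [k0 Hk0].
      assert (Hck : forall k : nat, admissible r J (vscale (Z.of_nat k) c1)).
      { intros k. apply admissible_scale; [lia | apply Hcadm]. }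
      (* A further factor [c1] turns [s 0] into [s 1], which multiplication by [c1^k] with [k >= k0]
         does not distinguish from [s 0]. So [c1^k] applied to [s 0] is the same [w] for all these
         [k]. *)
      pose (w := za (vscale (Z.of_nat k0) c1) (s 0%nat)).
      assert (Hw : forall k, (k0 <= k)%nat -> za (vscale (Z.of_nat k) c1) (s 0%nat) = w).
      { intros k Hk. induction Hk as [|k Hk IH]; [reflexivity|].
        rewrite <- IH, <- (Hk0 k Hk), (Hsc 1%nat). fold c1. rewrite (vactD Hza) by (auto; apply Hcadm).
        f_equal. vext. }
      destruct (@vec_bounded r c1) as [M [HM0 HM]]; [apply (Hcadm 1%nat)|].
      (* From this index on, [c n - k0 c1] is admissible: an exponent outside [J] is either
         constant, with entry zero in both vectors, or strictly increasing, with entry at least [n]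
         in [c n] and at most [k0 M] in [k0 c1]. *)
      exists (k0 * Z.to_nat M)%nat.
      assert (Hall : forall n, (k0 * Z.to_nat M <= n)%nat -> s n = w).
      { intros n Hn.
        pose (d := vadd (c n) (vscale (-1) (vscale (Z.of_nat k0) c1))).
        assert (Hd : admissible r J d).
        { destruct (Hcadm n) as [H1 [H2 _]]. destruct (Hck k0) as [H3 [H4 _]]. unfold d. repeat split.
          - rewrite vsum_add, vsum_scale. lia.
          - intros i Hi. specialize (H2 i Hi). specialize (H4 i Hi). unfold vadd, vscale in *. lia.
          - intros i Hi HJi. destruct (Hdich i Hi HJi) as [E|E].
            + unfold c1, c, vadd, vscale. rewrite (E n), (E 1%nat). lia.
            + assert (Hge : forall n', Z.of_nat n' <= z n' i - z 0%nat i).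
              { intros n'. induction n' as [|n' IH]; [lia|].
                specialize (E n' (Datatypes.S n')). lia. }
              specialize (Hge n). specialize (HM i). unfold vadd, vscale.
              assert (Z.of_nat k0 * c1 i <= Z.of_nat k0 * M) by nia.
              assert (Z.of_nat k0 * M <= Z.of_nat n) by nia.
              unfold c at 1, vadd, vscale. lia. }
        assert (Ecn : c n = vadd d (vscale (Z.of_nat k0) c1)) by (unfold d; vext).
        (* The power [c1^(k0 + k1)] applied to [s n] is computed in two ways: agreement with [s 0]
           gives [w], while [c n = d + k0 c1] gives [d] applied to [w], which is [s n]. *)
        destruct (Habs (s n) (s 0%nat) (HS _) (HS _)) as [k1 Hk1].
        specialize (Hk1 (k0 + k1)%nat ltac:(lia)). rewrite (Hw (k0 + k1)%nat) in Hk1 by lia.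
        rewrite <- Hk1, (Hsc n), Ecn, (vactD Hza) by auto using admissible_add.
        rewrite <- (vactD Hza) by auto.
        replace (vadd (vscale (Z.of_nat (k0 + k1)) c1) (vadd d (vscale (Z.of_nat k0) c1)))
          with (vadd d (vscale (Z.of_nat (k0 + k1 + k0)) c1)) by vext.
        rewrite <- (vactD Hza) by auto. rewrite (Hw (k0 + k1 + k0)%nat) by lia. reflexivity. }
      intros n Hn. rewrite !Hall by lia. reflexivity.
    (* Here every exponent outside [J] is constant along the sequence, against the choice of [s n]
       once [n] reaches the largest entry of [z 0]. *)
    - exfalso. destruct (@vec_bounded r (z 0%nat)) as [M [HM0 HM]]; [apply Hadm|].
      destruct (Hunb (Z.to_nat M) (z (Z.to_nat M)) (Hrep _)) as [i [Hi [HJi Hlt]]].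
      destruct (Hdich i Hi HJi) as [E|E].
      + rewrite E in Hlt. specialize (HM i). lia.
      + apply Hni. exists i. auto. }
  destruct Hconst as [n0 Hn0].
  (* The single vector [z n0] represents all later [s n], so its exponents would exceed every
     bound. *)
  destruct (@vec_bounded r (z n0)) as [M [HM0 HM]]; [apply Hadm|].
  destruct (Hunb (n0 + Z.to_nat M)%nat (z n0)) as [i [Hi [HJi Hlt]]].
  - rewrite Hn0 by lia. apply Hrep.
  - specialize (HM i). lia.
Qed.

(** Vectors supported in [J] are admissible together with their negatives, so the stabilizer of [s]
    among them is a subgroup and not merely a submonoid. *)
Lemma vact_linear_closed r J (T : Type) (za : vec -> T -> T) (s : T) :
  vaction r J za ->
  let H := fun u => vsum r u = 0 /\ supported r J u /\ za u s = s in
  forall a b u v, H u -> H v -> H (vadd (vscale a u) (vscale b v)).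
Proof.
  intros Hza H.
  assert (Hadm : forall u, vsum r u = 0 -> supported r J u -> admissible r J u).
  { intros u Hu Hs. repeat split; auto. intros i Hi HJ. rewrite Hs; [lia | auto]. }
  assert (Hadd : forall u v, H u -> H v -> H (vadd u v)).
  { intros u v [Hu [Hus Hue]] [Hv [Hvs Hve]]. repeat split.
    - rewrite vsum_add. lia.
    - intros i Hi. unfold vadd. rewrite Hus, Hvs by exact Hi. lia.
    - rewrite <- (vactD Hza), Hve by auto. exact Hue. }
  assert (Hopp : forall u, H u -> H (vscale (-1) u)).
  { intros u [Hu [Hus Hue]].
    assert (H1 : vsum r (vscale (-1) u) = 0) by (rewrite vsum_scale; lia).
    assert (H2 : supported r J (vscale (-1) u)).
    { intros i Hi. unfold vscale. rewrite Hus by exact Hi. lia. }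
    repeat split; auto.
    rewrite <- Hue at 1. rewrite (vactD Hza) by auto.
    replace (vadd _ _) with (fun _ : nat => 0) by vext. apply (vact0 Hza). }
  assert (Hnat : forall (n : nat) u, H u -> H (vscale (Z.of_nat n) u)).
  { intros n u Hu. induction n as [|n IH].
    - replace (vscale _ u) with (vadd u (vscale (-1) u)) by vext. auto.
    - replace (vscale _ u) with (vadd u (vscale (Z.of_nat n) u)) by vext. auto. }
  assert (Hz : forall k u, H u -> H (vscale k u)).
  { intros k u Hu. destruct (Z_le_gt_dec 0 k).
    - rewrite <- (Z2Nat.id k) by lia. auto.
    - replace (vscale k u) with (vscale (-1) (vscale (Z.of_nat (Z.to_nat (- k))) u)) by vext. auto. }
  auto.
Qed.

(** [S] is cut into cells in which, for each [j] in [J], the generator and the exponents outside [J]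
    of some representation are prescribed; [exponents_bounded] leaves finitely many. A cell lies in
    one orbit of the vectors supported in [J], and [lattice_bounded], applied to the stabilizer of a
    base point [s0], makes it finite. *)
Lemma finite_of_representations r J (T : Type) (za : vec -> T -> T) (S : T -> Prop) :
  vaction r J za -> (exists j, (j < r)%nat /\ J j = true) ->
  (forall j, (j < r)%nat -> J j = true -> exists L : list T,
     forall s, S s -> exists m z, In m L /\ represents r za j m z s) ->
  (forall s s', S s -> S s' -> agree_outside r J za s s') ->
  finite_pred S.
Proof.
  intros Hza [j0 [Hj0 HJj0]] Hgen Hag.
  pose (cls := fun j m (e : vec) s => exists z, represents r za j m z s /\
     forall i, (i < r)%nat -> J i = false -> z i = e i).
  pose (Q := fun j (P : T -> Prop) => exists m e, P = cls j m e).
  assert (Hidx : forall j, In j (filter J (seq 0 r)) <-> ((j < r)%nat /\ J j = true)).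
  { intros j. rewrite filter_In, in_seq. intuition lia. }
  apply finite_pred_refine with (Q := Q) (idx := filter J (seq 0 r)).
  - intros j Hj. apply Hidx in Hj. destruct Hj as [Hj HJj].
    destruct (Hgen j Hj HJj) as [L HL].
    assert (Hm : forall m, exists LP : list (T -> Prop), (forall P, In P LP -> Q j P) /\
        forall s, S s -> (exists z, represents r za j m z s) -> exists P, In P LP /\ P s).
    { intros m. destruct (@exponents_bounded r J T za S j m Hza Hj HJj Hag) as [E HE].
      destruct (bounded_vectors_finite r (Z.of_nat E)) as [l Hl].
      exists (map (cls j m) l). split.
      - intros P HP. apply in_map_iff in HP. destruct HP as [e [<- _]]. exists m, e. reflexivity.
      - intros s Hs Hz. destruct (HE s Hs Hz) as [z [Hrep Hzb]].
        (* Only the exponents outside [J] are bounded; those in [J] are set to zero before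
           counting. *)
        destruct (Hl (fun i => if J i then 0 else z i)) as [e [He Hev]].
        + intros i Hi. destruct (J i) eqn:EJ; [lia|]. specialize (Hzb i Hi EJ).
          pose proof (represents_admissible HJj Hrep) as [_ [_ Hp]]. specialize (Hp i Hi EJ). lia.
        + exists (cls j m e). split; [apply in_map; exact He|]. exists z. split; [exact Hrep|].
          intros i Hi EJ. rewrite (Hev i Hi), EJ. reflexivity. }
    destruct (functional_choice Hm) as [LP HLP].
    exists (flat_map LP L). split.
    + intros P HP. apply in_flat_map in HP. destruct HP as [m [_ HP]]. apply (HLP m). exact HP.
    + intros s Hs. destruct (HL s Hs) as [m [z [Hin Hz]]].
      destruct (HLP m) as [_ H]. destruct (H s Hs (ex_intro _ z Hz)) as [P [HP HPs]].
      exists P. split; [|exact HPs]. apply in_flat_map. exists m. auto.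
  - intros sg Hsg.
    destruct (classic (exists s0, S s0 /\ forall j, In j (filter J (seq 0 r)) -> sg j s0))
      as [[s0 [Hs0 Hsg0]]|Hempty]; [|exists []; intros s Hs; apply Hempty; exists s; exact Hs].
    (* [C] bounds from above the entries of one representation of [s0] at each [j] in [J]. *)
    destruct (@uniform_bound r (fun j C => J j = true -> exists m e z0, sg j = cls j m e /\
       represents r za j m z0 s0 /\ (forall i, (i < r)%nat -> J i = false -> z0 i = e i) /\
       forall i, z0 i <= Z.of_nat C)) as [C HC].
    + intros j k k' Hk HP HJj. destruct (HP HJj) as [m [e [z0 [H1 [H2 [H3 H4]]]]]].
      exists m, e, z0. repeat (split; [assumption|]). intros i. specialize (H4 i). lia.
    + intros j Hj. destruct (J j) eqn:HJj; [|exists O; discriminate].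
      assert (Hin : In j (filter J (seq 0 r))) by (apply Hidx; auto).
      destruct (Hsg j Hin) as [m [e Hme]]. specialize (Hsg0 j Hin). rewrite Hme in Hsg0.
      destruct Hsg0 as [z0 [Hrep He]].
      destruct (@vec_bounded r z0) as [M [HM0 HM]]; [apply Hrep|].
      exists (Z.to_nat M). intros _. exists m, e, z0. repeat (split; [assumption|]).
      intros i. specialize (HM i). lia.
    + pose (H := fun u => vsum r u = 0 /\ supported r J u /\ za u s0 = s0).
      destruct (@lattice_bounded r J H (Z.of_nat C)) as [B HB].
      { apply (@vact_linear_closed r J T za s0 Hza). }
      { intros u Hu. split; apply Hu. }
      { lia. }
      { exists j0. auto. }
      destruct (bounded_vectors_finite r B) as [l Hl].
      exists (map (fun v => za (fun i => if lt_dec i r then v i else 0) s0) l).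
      intros s [Hs Hsgs].
      assert (Hadm : forall u, vsum r u = 0 -> supported r J u -> admissible r J u).
      { intros u Hu Hsu. repeat split; auto. intros i Hi HJ. rewrite Hsu; [lia | auto]. }
      (* The representations of [s] and [s0] at [j] share the same [m], so [s] is [z - z0] applied
         to [s0]. This difference is supported in [J] as the outer exponents agree, and away from
         [j] it is at least [- C] as [z >= 0] and [z0 <= C]. *)
      assert (Hw : forall j, (j < r)%nat -> J j = true -> exists w, vsum r w = 0 /\
         supported r J w /\ za w s0 = s /\ forall i, i <> j -> - Z.of_nat C <= w i).
      { intros j Hj HJj. destruct (HC j Hj HJj) as [m [e [z0 [Esg [Hrep0 [He0 HzC]]]]]].
        specialize (Hsgs j (proj2 (Hidx j) (conj Hj HJj))). rewrite Esg in Hsgs.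
        destruct Hsgs as [z [Hrep He]].
        destruct (Hrep) as [Hz1 [Hz2 [Hz3 Hz4]]]. destruct (Hrep0) as [Hy1 [Hy2 [Hy3 Hy4]]].
        exists (vadd z (vscale (-1) z0)).
        assert (Hsum : vsum r (vadd z (vscale (-1) z0)) = 0) by (rewrite vsum_add, vsum_scale; lia).
        assert (Hsup : supported r J (vadd z (vscale (-1) z0))).
        { intros i Hi. unfold vadd, vscale. destruct (le_lt_dec r i) as [Hir|Hir].
          - rewrite Hz2, Hy2 by exact Hir. lia.
          - destruct Hi as [Hi|Hi]; [lia|]. rewrite He, He0 by auto. lia. }
        repeat split; auto.
        - rewrite Hy4, (vactD Hza) by eauto using represents_admissible.
          rewrite Hz4. f_equal. vext.
        - intros i Hij. specialize (HzC i). unfold vadd, vscale.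
          destruct (le_lt_dec r i) as [Hir|Hir].
          + rewrite Hz2, Hy2 by exact Hir. lia.
          + specialize (Hz3 i Hir Hij). lia. }
      destruct (Hw j0 Hj0 HJj0) as [w [Hw1 [Hw2 [Hw3 _]]]].
      assert (Hnw1 : vsum r (vscale (-1) w) = 0) by (rewrite vsum_scale; lia).
      assert (Hnw2 : supported r J (vscale (-1) w)).
      { intros i Hi. unfold vscale. rewrite Hw2 by exact Hi. lia. }
      destruct (HB w Hw1 Hw2) as [h [[Hh1 [Hh2 Hh3]] Hhb]].
      (* Both [w] and [w'] carry [s0] to [s], so [w' - w] stabilizes [s0]; added to [w] it gives
         [w'], which is bounded below away from [j]. *)
      { intros j Hj HJj. destruct (Hw j Hj HJj) as [w' [Hw1' [Hw2' [Hw3' Hw4']]]].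
        exists (vadd (vscale (-1) w) w'). split.
        - repeat split.
          + rewrite vsum_add. lia.
          + intros i Hi. unfold vadd. rewrite Hnw2, Hw2' by exact Hi. lia.
          + rewrite <- (vactD Hza) by auto. rewrite Hw3', <- Hw3, (vactD Hza) by auto.
            replace (vadd _ _) with (fun _ : nat => 0) by vext. apply (vact0 Hza).
        - intros i Hi. specialize (Hw4' i Hi). unfold vadd, vscale. lia. }
      (* Since [h] fixes [s0], the element [s] is also [w + h] applied to [s0], and [w + h] is
         bounded by [B]. The listed vectors match it only below [r], hence their truncation. *)
      destruct (Hl (vadd w h)) as [v [Hv Hvi]]; [intros i _; apply Hhb|].
      apply in_map_iff. exists v. split; [|exact Hv].
      rewrite <- Hw3, <- Hh3 at 1. rewrite Hh3.
      rewrite <- Hh3 at 2. rewrite (vactD Hza) by auto. f_equal.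
      apply functional_extensionality. intros i. destruct (lt_dec i r) as [Hi|Hi].
      * apply Hvi. exact Hi.
      * unfold vadd. rewrite Hw2, Hh2 by (left; lia). lia.
Qed.

Close Scope Z_scope.

(** * Charts of a coherent sheaf *)

Section MonoidFacts.
Variables (A : Monoid) (G : Grading A).
Local Infix "·" := (mmul A) (at level 40, left associativity).

Lemma mmulCA (a b c : A) : a · (b · c) = b · (a · c).
Proof. rewrite !mmulA, (mmulC a b). reflexivity. Qed.

Lemma mmul1r (a : A) : a · mone A = a.
Proof. rewrite mmulC. apply mmul1. Qed.

Lemma mmulACA (a b c d : A) : (a · b) · (c · d) = (a · c) · (b · d).
Proof. rewrite <- !mmulA, (mmulCA b c d). reflexivity. Qed.

Lemma mpow_add (a : A) m n : mpow a (m + n) = mpow a m · mpow a n.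
Proof.
  induction m as [|m IH]; simpl; [rewrite mmul1; reflexivity|].
  rewrite IH, mmulA. reflexivity.
Qed.

Lemma mpow_mmul (a b : A) n : mpow (a · b) n = mpow a n · mpow b n.
Proof.
  induction n as [|n IH]; simpl; [rewrite mmul1; reflexivity|].
  rewrite IH. apply mmulACA.
Qed.

Lemma mpow_mpow (a : A) m n : mpow (mpow a m) n = mpow a (m * n).
Proof.
  induction n as [|n IH]; simpl; [rewrite Nat.mul_0_r; reflexivity|].
  rewrite IH, <- mpow_add. f_equal. lia.
Qed.

(** If 1 had degree [i > 0], then [1 = 1 · 1] would also have degree [2 i], hence be zero, which
    lies in every degree. *)
Lemma part_one : part G 0 (mone A).
Proof.
  destruct (part_cover G (mone A)) as [i Hi]. destruct (Nat.eq_dec i 0) as [->|Hn]; [exact Hi|].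
  assert (H : part G (i + i) (mone A)) by (rewrite <- (mmul1 (mone A)); apply part_mul; exact Hi).
  rewrite (part_disj Hi H) by lia. apply part_zero.
Qed.

Lemma part_mpow d (a : A) n : part G d a -> part G (n * d) (mpow a n).
Proof.
  intros Ha. induction n as [|n IH]; simpl; [apply part_one | apply part_mul; assumption].
Qed.

Lemma pid_one (x : MProj G) : ~ pid x (mone A).
Proof. destruct (proj2_sig x) as [[_ [H _]] _]. exact H. Qed.

Lemma pid_zero (x : MProj G) : pid x (mzero A).
Proof. destruct (proj2_sig x) as [[H _] _]. exact H. Qed.

Lemma pid_mmul (x : MProj G) a b : pid x (a · b) <-> pid x a \/ pid x b.
Proof.
  destruct (proj2_sig x) as [[_ [_ [Hi Hp]]] _]. unfold pid. split; [apply Hp|].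
  intros [H|H]; [rewrite mmulC|]; apply Hi; exact H.
Qed.

Lemma pid_mpow (x : MProj G) a n : pid x (mpow a n) -> pid x a.
Proof.
  induction n as [|n IH]; simpl; [intros H; destruct (pid_one H)|].
  rewrite pid_mmul. tauto.
Qed.

Lemma pid_mpow_pos (x : MProj G) a n : 0 < n -> pid x a -> pid x (mpow a n).
Proof. intros Hn H. destruct n; [lia|]. simpl. apply pid_mmul. auto. Qed.

Lemma basic_open_proof (t : A) :
  forall x : MProj G, ~ pid x t -> exists f : A, ~ pid x f /\ forall y : MProj G, ~ pid y f -> ~ pid y t.
Proof. intros x Hx. exists t. auto. Qed.

Definition basic_open (t : A) : opens G :=
  {| oset := fun x => ~ pid x t; oopen := @basic_open_proof t |}.

(* The largest point of [D_+(a)]: the elements dividing no power of [a]. *)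
Lemma closed_point (a : A) : part G 1 a -> (forall n, mpow a n <> mzero A) ->
  exists x : MProj G, forall b, ~ pid x b -> exists c n, b · c = mpow a n.
Proof.
  intros Ha Hnil.
  assert (Hp : is_mproj_point G (fun b => ~ exists c n, b · c = mpow a n)).
  { split; [split; [|split; [|split]]|].
    - intros [c [n H]]. rewrite mmul0 in H. apply (Hnil n). congruence.
    - intros H. apply H. exists (mone A), 0. apply mmul1.
    - intros b c Hb [d [n H]]. apply Hb. exists (c · d), n. rewrite <- H, <- (mmulA c), mmulCA. reflexivity.
    - intros b c Hbc. apply NNPP. intros Hno. apply Hno. left. intros [d [n Hd]].
      apply Hno. right. intros [d' [n' Hd']]. apply Hbc. exists (d · d'), (n + n').
      rewrite mpow_add, <- Hd, <- Hd'. apply mmulACA.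
    - exists 1, a. repeat split; [lia | exact Ha |]. intros H. apply H.
      exists (mone A), 1. reflexivity. }
  exists (exist _ _ Hp). intros b Hb. apply NNPP. exact Hb.
Qed.

End MonoidFacts.

(** * Localized modules and sections over [D_+(a)] *)

Section Sheaf.
Variables (A : Monoid) (G : Grading A) (F : OSheaf G).
Local Infix "·" := (mmul A) (at level 40, left associativity).

(** Opens with the same points need not be equal as records; mutually inverse restrictions transport
    sections between them. *)
Lemma res_inverse (U V : opens G) (H : incl V U) (H' : incl U V) (s : sec F U) :
  res F H' (res F H s) = s.
Proof. rewrite (res_comp (o := F)) with (H3 := fun x Hx => Hx). apply res_id. Qed.

(** The empty family covers [U], so locality has nothing to compare. *)
Lemma sec_empty (U : opens G) : (forall x, ~ oset U x) -> forall s t : sec F U, s = t.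
Proof.
  intros HU s t.
  apply (@sh_locality A G F U False (fun _ => U) (fun i => match i with end)).
  - intros x Hx. destruct (HU x Hx).
  - intros [].
Qed.

Lemma feq_cross (U : opens G) (b t b' t' : A) : b · t' = b' · t -> feq U b t b' t'.
Proof. intros H. exists (mone A). split; [intros x _; apply pid_one | rewrite H; reflexivity]. Qed.

Lemma loc_eq_sym h d (N : HMod G h d) a n p q : loc_eq N a n p q -> loc_eq N a n q p.
Proof. destruct p, q. intros [j Hj]. exists j. symmetry. exact Hj. Qed.

Lemma nact_comp h d (N : HMod G h d) c m c' m' c'' m'' y :
  part G (m * d) c -> part G (m' * d) c' -> c'' = c · c' -> m'' = m + m' ->
  nact N c'' m'' y = nact N c m (nact N c' m' y).
Proof. intros H H' -> ->. symmetry. apply nact_mul; assumption. Qed.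

Lemma part_mpow_mul d n (a : A) j : part G (n * d) a -> part G (n * j * d) (mpow a j).
Proof. intros H. replace (n * j * d) with (j * (n * d)) by lia. apply part_mpow. exact H. Qed.

Lemma loc_eq_trans h d (N : HMod G h d) a n p q p' : part G (n * d) a ->
  loc_eq N a n p q -> loc_eq N a n q p' -> loc_eq N a n p p'.
Proof.
  intros Ha. destruct p as [y k], q as [y1 k1], p' as [y2 k2]. intros [j Hj] [j' Hj'].
  exists (j + j' + k1).
  rewrite (@nact_comp h d N (mpow a (j' + k2)) (n * (j' + k2)) (mpow a (j + k1)) (n * (j + k1)));
    [| apply part_mpow_mul; exact Ha | apply part_mpow_mul; exact Ha
     | rewrite <- mpow_add; f_equal; lia | lia].
  rewrite Hj.
  rewrite <- (@nact_comp h d N _ _ _ _ (mpow a (j' + k2 + (j + k))) (n * (j' + k2 + (j + k))));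
    [| apply part_mpow_mul; exact Ha | apply part_mpow_mul; exact Ha
     | rewrite <- mpow_add; f_equal; lia | lia].
  rewrite (@nact_comp h d N (mpow a (j + k)) (n * (j + k)) (mpow a (j' + k2)) (n * (j' + k2)));
    [| apply part_mpow_mul; exact Ha | apply part_mpow_mul; exact Ha
     | rewrite <- mpow_add; f_equal; lia | lia].
  rewrite Hj'. symmetry. apply nact_comp;
    [ apply part_mpow_mul; exact Ha | apply part_mpow_mul; exact Ha
     | rewrite <- mpow_add; f_equal; lia | lia].
Qed.

Lemma loc_eq_nact h d (N : HMod G h d) a n c m i y k y' k' :
  part G (n * d) a -> part G (m * d) c ->
  loc_eq N a n (y, k) (y', k') ->
  loc_eq N a n (nact N c m y, i + k) (nact N c m y', i + k').
Proof.
  intros Ha Hc [j Hj]. exists j.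
  assert (Hci : part G ((m + n * i) * d) (c · mpow a i)).
  { rewrite Nat.mul_add_distr_r. apply part_mul; [exact Hc | apply part_mpow_mul; exact Ha]. }
  assert (E : forall l z, nact N (mpow a (j + (i + l))) (n * (j + (i + l))) (nact N c m z) =
                nact N (c · mpow a i) (m + n * i) (nact N (mpow a (j + l)) (n * (j + l)) z)).
  { intros l z. rewrite !nact_mul by (assumption || apply part_mpow_mul; exact Ha).
    f_equal; [|lia]. rewrite (mmulC (mpow a _) c), <- mmulA, <- mpow_add. do 2 f_equal. lia. }
  rewrite !E, Hj. reflexivity.
Qed.

(** The chart [D_+(h)] around the closed point of [D_+(a)] contains all of [D_+(a)]: an element
    outside that point divides a power of [a]. If [a] is nilpotent, [D_+(a)] is empty and has no
    such point. *)
Lemma chart (Hcoh : coherent F) (a : A) : part G 1 a ->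
  (exists n, mpow a n = mzero A) \/
  exists h d c e, 0 < d /\ part G d h /\ part G e c /\ h · c = mpow a (d + e) /\
  exists N : HMod G h d, fin_gen_mod N /\ tilde_iso F N.
Proof.
  intros Ha. destruct (classic (exists n, mpow a n = mzero A)) as [H|Hnil]; [left; exact H|right].
  destruct (@closed_point A G a Ha) as [x Hx]; [intros n Hn; apply Hnil; exists n; exact Hn|].
  destruct (Hcoh x) as [h [d [Hd0 [Hd [Hxh HN]]]]].
  destruct (Hx h Hxh) as [c [n Hc]]. destruct (part_cover G c) as [e He].
  exists h, d, c, e. split; [exact Hd0|]. split; [exact Hd|]. split; [exact He|]. split; [|exact HN].
  rewrite Hc. f_equal.
  (* A nonzero element has only one degree, which forces the exponent to be [d + e]. *)
  assert (H1 : part G n (mpow a n)).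
  { rewrite <- (Nat.mul_1_r n) at 1. apply part_mpow. exact Ha. }
  assert (H2 : part G (d + e) (mpow a n)) by (rewrite <- Hc; apply part_mul; assumption).
  destruct (Nat.eq_dec n (d + e)) as [E|E]; [exact E|].
  exfalso. apply Hnil. exists n. apply (part_disj H1 H2 E).
Qed.

Lemma basic_open_nilpotent (a : A) n : mpow a n = mzero A -> forall x, ~ oset (basic_open G a) x.
Proof. intros H x Hx. apply Hx. apply pid_mpow with n. rewrite H. apply pid_zero. Qed.

(** Passing to [t^d] changes no points but makes the degree a multiple of [d], as required to write
    [D_+(t)] as a basic open set of the affine chart [D_+(h)]. *)
Lemma basic_open_chart (h c t : A) d m n : h · c = m -> (forall x : MProj G, pid x m -> pid x t) ->
  0 < d -> n = mpow t d ->
  incl (W G h n) (basic_open G t) /\ incl (basic_open G t) (W G h n).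
Proof.
  intros Hhc Hm Hd ->. split.
  - intros x [_ Hx] H. apply Hx. apply pid_mpow_pos; assumption.
  - intros x Hx. split; intros H; apply Hx.
    + apply Hm. rewrite <- Hhc. apply pid_mmul. left. exact H.
    + apply pid_mpow with d. exact H.
Qed.

(** The sections over [D_+(a)] form the localization of [N] at [g = a^d / h], generated by the
    generators of [N] once [g] is inverted. The relation [h c = a^(d+e)] converts all denominators
    into powers of [a]. *)
Lemma chart_generators (Hcoh : coherent F) (a : A) : part G 1 a ->
  exists L : list (sec F (basic_open G a)), forall s, exists m b k,
    In m L /\ part G k b /\ s = act F (basic_open G a) b (mpow a k) m.
Proof.
  intros Ha.
  destruct (chart Hcoh Ha)
    as [[n Hn]|[h [d [c [e [Hd0 [Hh [He [Hhc [N [[gens Hgens] [th [th' Hth]]]]]]]]]]]]].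
  - exists [spt F (basic_open G a)]. intros s. exists (spt F (basic_open G a)), (mone A), 0.
    split; [left; reflexivity|]. split; [apply part_one|].
    apply sec_empty. apply basic_open_nilpotent with n. exact Hn.
  - assert (Hd : part G (1 * d) (mpow a d)).
    { rewrite Nat.mul_1_l. rewrite <- (Nat.mul_1_r d) at 1. apply part_mpow. exact Ha. }
    destruct (Hth (mpow a d) 1 Hd) as [Hth1 [Hth2 [Hth3 [_ [_ Hact]]]]].
    destruct (@basic_open_chart h c a d _ _ Hhc (fun x => @pid_mpow A G x a (d + e)) Hd0 eq_refl) as [HV HU].
    exists (map (fun g => res F HU (th' (mpow a d) 1 (g, 0))) gens).
    intros s. set (s1 := res F HV s).
    destruct (th (mpow a d) 1 s1) as [y i] eqn:Ey.
    destruct (Hgens y) as [c0 [m [g [Hg [Hc0 Hy]]]]].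
    (* For [y = (c0 / h^m) g], with [g] a generator of [N], the scalar in front of [g] is
       [c0 h^i / (h^m a^(d i))]; expanding by [c^m] gives this numerator over a power of [a]. *)
    exists (res F HU (th' (mpow a d) 1 (g, 0))), (c0 · mpow h i · mpow c m), (m * (d + e) + d * i).
    split; [apply in_map_iff; exists g; auto|].
    assert (Hb : part G (m * (d + e) + d * i) (c0 · mpow h i · mpow c m)).
    { replace (m * (d + e) + d * i) with (m * d + i * d + m * e) by lia.
      apply part_mul; [apply part_mul|]; auto using part_mpow. }
    split; [exact Hb|].
    set (V := W G h (mpow a d)) in *. set (gm := th' (mpow a d) 1 (g, 0)).
    assert (HfU : forall U, incl U V -> frac U (c0 · mpow h i · mpow c m) (mpow a (m * (d + e) + d * i))).
    { intros U HUV. split.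
      - intros x Hx H. apply (HV x (HUV x Hx)). apply pid_mpow in H. exact H.
      - exists (m * (d + e) + d * i). split; [exact Hb|].
        rewrite <- (Nat.mul_1_r (m * (d + e) + d * i)) at 1. apply part_mpow. exact Ha. }
    assert (Hf : frac V (c0 · mpow h (1 * i)) (mpow h m · mpow (mpow a d) i)).
    { split.
      - intros x [Hxh Hxa] H. apply pid_mmul in H. destruct H as [H|H]; apply pid_mpow in H; auto.
      - exists (m * d + i * d). rewrite Nat.mul_1_l in *. split; apply part_mul; auto using part_mpow. }
    (* The equality is first checked in the localized module, where [gm] corresponds to the class of
       [(g, 0)]; then the fraction is replaced by the equal one with denominator a power of [a]. *)
    assert (Es1 : s1 = act F V (c0 · mpow h i · mpow c m) (mpow a (m * (d + e) + d * i)) gm).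
    { transitivity (act F V (c0 · mpow h (1 * i)) (mpow h m · mpow (mpow a d) i) gm).
      - rewrite <- (Hth1 s1), Ey. rewrite <- (Hth1 (act F V _ _ gm)).
        specialize (Hact c0 m i gm Hc0). destruct (th (mpow a d) 1 gm) as [y' i'] eqn:Ey'.
        rewrite (Hth3 _ _ Hact). apply Hth3.
        specialize (Hth2 (g, 0)). fold gm in Hth2. rewrite Ey' in Hth2.
        rewrite Hy. apply loc_eq_sym. rewrite <- (Nat.add_0_r i) at 2.
        apply loc_eq_nact; assumption.
      - apply act_wd; [exact Hf | apply HfU; exact (fun x Hx => Hx) | apply feq_cross]. rewrite Nat.mul_1_l, mpow_mpow, mpow_add.
        replace (m * (d + e)) with ((d + e) * m) by lia. rewrite <- mpow_mpow, <- Hhc, mpow_mmul.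
        rewrite !mmulA. f_equal. rewrite <- !mmulA. do 2 f_equal. apply mmulC. }
    rewrite <- (res_inverse HV HU s). fold s1. rewrite Es1.
    apply act_res. apply HfU. exact (fun x Hx => Hx).
Qed.

(** Equality over [D_+(t f)] is equality in the localization of [N] at the product of [t^d / h^e0]
    and [f^d / h], so a power of the second factor already equalizes the sections over [D_+(t)].
    Finally the denominator [h^M] is traded for a power of [a]. *)
Lemma agree_power (Hcoh : coherent F) (a t f : A) e0 (s s' : sec F (basic_open G t))
    (H : incl (basic_open G (t · f)) (basic_open G t)) :
  part G 1 a -> part G e0 t -> part G 1 f -> incl (basic_open G t) (basic_open G a) ->
  res F H s = res F H s' ->
  exists k, act F (basic_open G t) (mpow f k) (mpow a k) s
          = act F (basic_open G t) (mpow f k) (mpow a k) s'.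
Proof.
  intros Ha Ht Hf Hta Hss.
  destruct (chart Hcoh Ha)
    as [[n Hn]|[h [d [c [e [Hd0 [Hh [He [Hhc [N [_ [th [th' Hth]]]]]]]]]]]]].
  - exists 0. apply sec_empty. intros x Hx. apply (basic_open_nilpotent Hn (Hta x Hx)).
  - assert (Htd : part G (e0 * d) (mpow t d)).
    { rewrite Nat.mul_comm. apply part_mpow. exact Ht. }
    assert (Hfd : part G (1 * d) (mpow f d)).
    { rewrite Nat.mul_1_l. rewrite <- (Nat.mul_1_r d) at 1. apply part_mpow. exact Hf. }
    assert (Hpid : forall x : MProj G, pid x (mpow a (d + e)) -> pid x t).
    { intros x Hx. apply NNPP. intros Hxt. apply (Hta x Hxt). apply pid_mpow with (d + e). exact Hx. }
    destruct (@basic_open_chart h c t d _ _ Hhc Hpid Hd0 eq_refl) as [HV HU].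
    destruct (@basic_open_chart h c (t · f) d _ (mpow t d · mpow f d) Hhc) as [HV' HU'];
      [intros x Hx; apply pid_mmul; auto | exact Hd0 | symmetry; apply mpow_mmul |].
    set (V := W G h (mpow t d)) in *. set (V' := W G h (mpow t d · mpow f d)) in *.
    assert (HVV : incl V' V) by (intros x Hx; apply HU, H, HV', Hx).
    set (s1 := res F HV s). set (s1' := res F HV s').
    assert (Hs1 : res F HVV s1 = res F HVV s1').
    { unfold s1, s1'. rewrite !(res_comp (o := F)) with (H3 := fun x Hx => H x (HV' x Hx)).
      rewrite <- !(res_comp (o := F)) with (H1 := H) (H2 := HV'). rewrite Hss. reflexivity. }
    destruct (Hth (mpow t d) e0 Htd) as [Hth1 [_ [Hth3 [_ [Hres Hact]]]]].
    pose proof (Hres (mpow f d) 1 HVV s1 Hfd) as R1.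
    assert (R2 : loc_eq N (mpow t d · mpow f d) (e0 + 1) (th _ (e0 + 1) (res F HVV s1))
       (let (y, k) := th (mpow t d) e0 s1' in (nact N (mpow (mpow f d) k) (1 * k) y, k)))
      by (rewrite Hs1; apply Hres; exact Hfd).
    destruct (th (mpow t d) e0 s1) as [y k] eqn:Ey.
    destruct (th (mpow t d) e0 s1') as [y' k'] eqn:Ey'.
    assert (Htf : part G ((e0 + 1) * d) (mpow t d · mpow f d)).
    { rewrite Nat.mul_add_distr_r. apply part_mul; assumption. }
    destruct (loc_eq_trans Htf (loc_eq_sym R1) R2) as [j Hj].
    (* The two sides of [Hj] carry the exponents [j + k'] plus [k] and [j + k] plus [k'] of
       [f^d / h]; both sums are [M]. *)
    set (M := j + k + k').
    assert (HfM : part G (M * d) (mpow f (d * M))).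
    { rewrite <- mpow_mpow. replace M with (1 * M) at 1 by lia. apply part_mpow_mul. exact Hfd. }
    assert (Hloc : loc_eq N (mpow t d) e0 (nact N (mpow f (d * M)) M y, 0 + k)
                                        (nact N (mpow f (d * M)) M y', 0 + k')).
    { exists j. simpl.
      assert (E : forall l l' z, l + l' = k + k' ->
        nact N (mpow (mpow t d) (j + l)) (e0 * (j + l)) (nact N (mpow f (d * M)) M z)
        = nact N (mpow (mpow t d · mpow f d) (j + l)) ((e0 + 1) * (j + l))
            (nact N (mpow (mpow f d) l') (1 * l') z)).
      { intros l l' z Hl.
        rewrite !nact_mul by (assumption || apply part_mpow_mul; assumption).
        f_equal; [|unfold M; lia].
        rewrite mpow_mmul, <- mmulA, <- mpow_add, <- mpow_mpow. do 2 f_equal. unfold M. lia. }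
      rewrite (E k' k y) by lia. rewrite (E k k' y') by lia. exact Hj. }
    (* This is [f^(d M) / h^M], written as in the case [i = 0] of the compatibility with the
       action. *)
    assert (Hfr : frac V (mpow f (d * M) · mpow h (e0 * 0)) (mpow h M · mpow (mpow t d) 0)).
    { split.
      - intros x [Hxh Hxt] Hx. apply pid_mmul in Hx. destruct Hx as [Hx|Hx]; apply pid_mpow in Hx; auto.
      - exists (M * d + 0). split; apply part_mul; auto using part_mpow;
          [rewrite Nat.mul_0_r|]; apply part_one. }
    assert (Ea : forall U, incl U V -> frac U (mpow h M) (mpow a (d * M))).
    { intros U HUV. split.
      - intros x Hx Hxa. apply pid_mpow in Hxa. apply (Hta x (HV x (HUV x Hx)) Hxa).
      - exists (d * M). split; [rewrite Nat.mul_comm; apply part_mpow; exact Hh|].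
        rewrite <- (Nat.mul_1_r (d * M)) at 1. apply part_mpow. exact Ha. }
    assert (Ef : forall U, incl U V -> frac U (mpow f (d * M)) (mpow a (d * M))).
    { intros U HUV. split; [apply (Ea U HUV)|].
      exists (d * M). split; rewrite <- (Nat.mul_1_r (d * M)) at 1; apply part_mpow; assumption. }
    assert (Eact : act F V (mpow f (d * M)) (mpow a (d * M)) s1
                 = act F V (mpow f (d * M)) (mpow a (d * M)) s1').
    { assert (E : act F V (mpow f (d * M) · mpow h (e0 * 0)) (mpow h M · mpow (mpow t d) 0) s1
                = act F V (mpow f (d * M) · mpow h (e0 * 0)) (mpow h M · mpow (mpow t d) 0) s1').
      { pose proof (Hact (mpow f (d * M)) M 0 s1 HfM) as A1.
        pose proof (Hact (mpow f (d * M)) M 0 s1' HfM) as A2.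
        rewrite Ey in A1. rewrite Ey' in A2.
        etransitivity; [symmetry; apply Hth1|]. etransitivity; [apply Hth3, A1|].
        etransitivity; [apply Hth3, Hloc|]. etransitivity; [symmetry; apply Hth3, A2|]. apply Hth1. }
      pose proof (Ea V (fun x Hx => Hx)) as EaV.
      (* The fraction [f^(d M) / a^(d M)] is [h^M / a^(d M)] times [f^(d M) / h^M]. *)
      assert (E2 : forall z, act F V (mpow f (d * M)) (mpow a (d * M)) z
         = act F V (mpow h M) (mpow a (d * M))
            (act F V (mpow f (d * M) · mpow h (e0 * 0)) (mpow h M · mpow (mpow t d) 0) z)).
      { intros z. rewrite act_mul by assumption. apply act_wd.
        - apply Ef. exact (fun x Hx => Hx).
        - destruct EaV as [D1 [i1 [P1 Q1]]]. destruct Hfr as [D2 [i2 [P2 Q2]]]. split.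
          + intros x Hx Hm. apply pid_mmul in Hm. destruct Hm; [apply (D1 x Hx) | apply (D2 x Hx)]; assumption.
          + exists (i1 + i2). split; apply part_mul; assumption.
        - apply feq_cross. rewrite Nat.mul_0_r. simpl. rewrite !mmul1r.
          rewrite (mmulC (mpow a _)), mmulA, (mmulC (mpow h M)). reflexivity. }
      rewrite !E2, E. reflexivity. }
    exists (d * M).
    assert (Eback : forall z, act F (basic_open G t) (mpow f (d * M)) (mpow a (d * M)) z
       = res F HU (act F V (mpow f (d * M)) (mpow a (d * M)) (res F HV z))).
    { intros z. rewrite act_res by (apply Ef; exact (fun x Hx => Hx)).
      rewrite res_inverse. reflexivity. }
    rewrite !Eback. fold s1 s1'. rewrite Eact. reflexivity.
Qed.

End Sheaf.

(** * Global sections *)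

Section Monomials.
Variables (A : Monoid) (G : Grading A) (F : OSheaf G) (gen : nat -> A).
Local Infix "·" := (mmul A) (at level 40, left associativity).

(** Negative exponents are truncated to zero, so this is the expected monomial for nonnegative
    vectors only. *)
Fixpoint mon (r : nat) (u : vec) : A :=
  match r with O => mone A | S r => mon r u · mpow (gen r) (Z.to_nat (u r)) end.

Definition nonneg (u : vec) : Prop := forall i, (0 <= u i)%Z.

Lemma mon_vadd r u v : nonneg u -> nonneg v -> mon r (vadd u v) = mon r u · mon r v.
Proof.
  intros Hu Hv. induction r as [|r IH]; simpl; [rewrite mmul1; reflexivity|].
  rewrite IH. unfold vadd. rewrite Z2Nat.inj_add, mpow_add by auto. apply mmulACA.
Qed.

Lemma mon_scale_unit r k i : i < r -> mon r (vscale (Z.of_nat k) (vunit i)) = mpow (gen i) k.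
Proof.
  assert (H0 : forall r, r <= i -> mon r (vscale (Z.of_nat k) (vunit i)) = mone A).
  { clear r. intros r. induction r as [|r IH]; intros Hr; simpl; [reflexivity|].
    rewrite IH by lia. unfold vscale, vunit. destruct (Nat.eq_dec r i); [lia|].
    rewrite Z.mul_0_r. apply mmul1. }
  induction r as [|r IH]; intros Hi; [lia|]. simpl.
  unfold vscale at 2. unfold vunit at 2. destruct (Nat.eq_dec r i) as [->|Hn].
  - rewrite H0, Z.mul_1_r, Nat2Z.id by lia. apply mmul1.
  - rewrite IH, Z.mul_0_r by lia. apply mmul1r.
Qed.

Lemma mon_unit r i : i < r -> mon r (vunit i) = gen i.
Proof.
  intros Hi. replace (vunit i) with (vscale (Z.of_nat 1) (vunit i)) by vext.
  rewrite mon_scale_unit by exact Hi. apply mmul1r.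
Qed.

Lemma mon_zero r : mon r (fun _ => 0%Z) = mone A.
Proof. induction r as [|r IH]; simpl; [reflexivity|]. rewrite IH. apply mmul1. Qed.

Lemma part_mon r u k : (forall i, i < r -> part G 1 (gen i)) -> nonneg u ->
  vsum r u = Z.of_nat k -> part G k (mon r u).
Proof.
  intros Hg Hu. revert k. induction r as [|r IH]; simpl; intros k Hk.
  - replace k with 0 by lia. apply part_one.
  - pose proof (@vsum_nonneg r u (fun i _ => Hu i)). specialize (Hu r).
    replace k with (Z.to_nat (vsum r u) + Z.to_nat (u r) * 1) by lia.
    apply part_mul; [apply IH; [intros; apply Hg|]; lia | apply part_mpow, Hg; lia].
Qed.

Lemma pid_mon (x : MProj G) r u : nonneg u -> pid x (mon r u) ->
  exists i, i < r /\ (0 < u i)%Z /\ pid x (gen i).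
Proof.
  intros Hu. induction r as [|r IH]; simpl; [intros H; destruct (pid_one H)|].
  intros H. apply pid_mmul in H. destruct H as [H|H].
  - destruct (IH H) as [i [Hi Hx]]. exists i. split; [lia | exact Hx].
  - exists r. split; [lia|]. split; [|apply pid_mpow in H; exact H].
    destruct (Z_lt_le_dec 0 (u r)) as [Hl|Hl]; [exact Hl|]. exfalso.
    replace (Z.to_nat (u r)) with 0 in H by lia. exact (pid_one H).
Qed.

Lemma pid_mon_gen (x : MProj G) r u i : nonneg u -> i < r -> (0 < u i)%Z ->
  pid x (gen i) -> pid x (mon r u).
Proof.
  intros Hu Hi Hui Hx.
  assert (Hn : nonneg (vadd u (vscale (-1) (vunit i)))).
  { intros l. specialize (Hu l). unfold vadd, vscale, vunit.
    destruct (Nat.eq_dec l i) as [->|]; lia. }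
  replace u with (vadd (vunit i) (vadd u (vscale (-1) (vunit i)))) by vext.
  rewrite mon_vadd, mon_unit; [apply pid_mmul; left; exact Hx | exact Hi | | exact Hn].
  intros l. unfold vunit. destruct (Nat.eq_dec l i); lia.
Qed.

(** With [A_0 = {0,1}] the coefficient in degree zero is trivial, so a nonzero element is a product
    of generators; the number of factors is [k] because the degree of a nonzero element is
    unique. *)
Lemma homogeneous_mon r k b :
  A0_is_01 G -> fin_gen_by_A1 G -> (forall a, part G 1 a -> exists i, i < r /\ gen i = a) ->
  part G k b -> b = mzero A \/ exists u, nonneg u /\ (forall i, r <= i -> u i = 0%Z) /\
    vsum r u = Z.of_nat k /\ b = mon r u.
Proof.
  intros H0 [_ Hfg] Hgen Hb. destruct (classic (b = mzero A)) as [E|Hnz]; [left; exact E | right].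
  destruct (Hfg b) as [b0 [l [Hb0 [Hl Eb]]]].
  destruct (H0 b0 Hb0) as [->| ->]; [exfalso; apply Hnz; rewrite Eb; apply mmul0|].
  rewrite mmul1 in Eb.
  assert (Hu : exists u, nonneg u /\ (forall i, r <= i -> u i = 0%Z) /\
     vsum r u = Z.of_nat (length l) /\ fold_right (mmul A) (mone A) l = mon r u).
  { clear Eb Hnz. induction Hl as [|a l Ha Hl [u [Hu [Hur [Hd E]]]]].
    - exists (fun _ => 0%Z). split; [intros i; lia|]. split; [reflexivity|]. split.
      + apply vsum_zero.
      + symmetry. apply mon_zero.
    - destruct (Hgen a Ha) as [i [Hi Ei]].
      assert (Hi0 : nonneg (vunit i)) by (intros j; unfold vunit; destruct (Nat.eq_dec j i); lia).
      exists (vadd (vunit i) u). split; [|split; [|split]].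
      + intros j. specialize (Hu j). specialize (Hi0 j). unfold vadd. lia.
      + intros j Hj. unfold vadd, vunit. rewrite (Hur j Hj). destruct (Nat.eq_dec j i); lia.
      + rewrite vsum_add, vsum_unit, Hd. simpl length. destruct (lt_dec i r); lia.
      + rewrite mon_vadd, mon_unit by assumption. simpl. rewrite E, Ei. reflexivity. }
  destruct Hu as [u [Hu [Hur [Hd E]]]].
  exists u. repeat (split; [assumption|]). split; [|rewrite Eb; exact E]. rewrite Hd. f_equal.
  assert (Hbl : part G (length l) b).
  { rewrite Eb. clear - Hl. induction Hl as [|a l Ha Hl IH]; simpl; [apply part_one|].
    apply (part_mul Ha IH). }
  apply NNPP. intros Hn. apply Hnz. apply (part_disj Hbl Hb Hn).
Qed.

(** * Laurent monomials of degree zero acting on sections *)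

Definition vpos (z : vec) : vec := fun i => Z.max 0 (z i).
Definition vneg (z : vec) : vec := fun i => Z.max 0 (- z i).

Definition vact (r : nat) (U : opens G) (z : vec) (s : sec F U) : sec F U :=
  act F U (mon r (vpos z)) (mon r (vneg z)) s.

Arguments vact : clear implicits.

Lemma frac_mon r J (U : opens G) u v :
  (forall i, i < r -> part G 1 (gen i)) ->
  (forall i, i < r -> J i = true -> forall x, oset U x -> ~ pid x (gen i)) ->
  nonneg u -> nonneg v -> vsum r u = vsum r v ->
  (forall i, i < r -> J i = false -> v i = 0%Z) ->
  frac U (mon r u) (mon r v).
Proof.
  intros Hg HU Hu Hv Huv HJ. split.
  - intros x Hx H. apply pid_mon in H; [|exact Hv]. destruct H as [i [Hi [Hvi Hxi]]].
    destruct (J i) eqn:EJ; [apply (HU i Hi EJ x Hx Hxi)|]. rewrite (HJ i Hi EJ) in Hvi. lia.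
  - pose proof (@vsum_nonneg r u (fun i _ => Hu i)).
    exists (Z.to_nat (vsum r u)). split; apply part_mon; auto; lia.
Qed.

Lemma frac_vact r J (U : opens G) z :
  (forall i, i < r -> part G 1 (gen i)) ->
  (forall i, i < r -> J i = true -> forall x, oset U x -> ~ pid x (gen i)) ->
  admissible r J z -> frac U (mon r (vpos z)) (mon r (vneg z)).
Proof.
  intros Hg HU [Hz1 [Hz2 Hz3]]. apply frac_mon with J; auto.
  - intros i. unfold vpos. lia.
  - intros i. unfold vneg. lia.
  - replace (vpos z) with (vadd z (vneg z)) by (vext; unfold vneg, vpos; lia).
    rewrite vsum_add. lia.
  - intros i Hi HJ. specialize (Hz3 i Hi HJ). unfold vneg. lia.
Qed.

(** Cross multiplication reduces any fraction of monomials to the normal form used by [vact], in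
    which numerator and denominator have disjoint supports. *)
Lemma act_mon r J (U : opens G) u v s :
  (forall i, i < r -> part G 1 (gen i)) ->
  (forall i, i < r -> J i = true -> forall x, oset U x -> ~ pid x (gen i)) ->
  nonneg u -> nonneg v -> vsum r u = vsum r v ->
  (forall i, r <= i -> u i = 0%Z /\ v i = 0%Z) ->
  (forall i, i < r -> J i = false -> v i = 0%Z) ->
  act F U (mon r u) (mon r v) s = vact r U (vadd u (vscale (-1) v)) s.
Proof.
  intros Hg HU Hu Hv Huv Hr HJ. apply act_wd.
  - apply frac_mon with J; auto.
  - apply frac_vact with J; auto. repeat split.
    + rewrite vsum_add, vsum_scale. lia.
    + intros i Hi. destruct (Hr i Hi) as [E1 E2]. unfold vadd, vscale. lia.
    + intros i Hi EJ. specialize (Hu i). specialize (HJ i Hi EJ). unfold vadd, vscale. lia.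
  - apply feq_cross. rewrite <- !mon_vadd; auto.
    + f_equal. vext. unfold vpos, vneg. lia.
    + intros i. unfold vpos. lia.
    + intros i. unfold vneg. lia.
Qed.

Lemma vact_vaction r J (U : opens G) :
  (forall i, i < r -> part G 1 (gen i)) ->
  (forall i, i < r -> J i = true -> forall x, oset U x -> ~ pid x (gen i)) ->
  vaction r J (vact r U).
Proof.
  intros Hg HU. split.
  - intros s. unfold vact. change (vpos (fun _ => 0%Z)) with (fun _ : nat => 0%Z).
    change (vneg (fun _ => 0%Z)) with (fun _ : nat => 0%Z). rewrite mon_zero. apply act_one.
  - intros u v s Hu Hv. unfold vact at 1 2.
    assert (Hp : forall z, nonneg (vpos z)) by (intros z i; unfold vpos; lia).
    assert (Hn : forall z, nonneg (vneg z)) by (intros z i; unfold vneg; lia).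
    assert (Hpn : forall z, admissible r J z -> vsum r (vpos z) = vsum r (vneg z)).
    { intros z [Hz _]. replace (vpos z) with (vadd z (vneg z)) by (vext; unfold vneg, vpos; lia).
      rewrite vsum_add. lia. }
    rewrite act_mul by (apply frac_vact with J; assumption).
    rewrite <- !mon_vadd by auto. rewrite act_mon with (J := J); auto.
    + f_equal. vext. unfold vpos, vneg. lia.
    + intros i. unfold vadd, vpos. lia.
    + intros i. unfold vadd, vneg. lia.
    + rewrite !vsum_add, !Hpn by assumption. reflexivity.
    + intros i Hi. destruct Hu as [_ [Hu _]]. destruct Hv as [_ [Hv _]].
      unfold vadd, vpos, vneg. rewrite Hu, Hv by exact Hi. split; reflexivity.
    + intros i Hi EJ. destruct Hu as [_ [_ Hu]]. destruct Hv as [_ [_ Hv]].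
      specialize (Hu i Hi EJ). specialize (Hv i Hi EJ). unfold vadd, vneg. lia.
Qed.

(** * Images of the global sections over the opens [U_J] *)

Definition indicator (J : nat -> bool) : vec := fun i => if J i then 1%Z else 0%Z.

Lemma vsum_indicator_le r J : (vsum r (indicator J) <= Z.of_nat r)%Z.
Proof.
  induction r as [|r IH]; simpl vsum; [lia|]. unfold indicator at 2. destruct (J r); lia.
Qed.

Lemma incl_topen (U : opens G) : incl U (topen G).
Proof. intros x _. exact I. Qed.

(** Descending induction on [J], with [n] bounding the number of indices outside [J]. Here [t] is
    the product of the [a_j], [j] in [J]; it is a variable with an equation, so that the larger
    index set can be used with the product [t · gen i] itself. *)
Lemma image_finite r (H0 : A0_is_01 G) (Hfg : fin_gen_by_A1 G) (Hcoh : coherent F)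
  (Hg1 : forall i, i < r -> part G 1 (gen i))
  (Hg2 : forall a, part G 1 a -> exists i, i < r /\ gen i = a) (n : nat) :
  forall J t, t = mon r (indicator J) -> (Z.of_nat r - Z.of_nat n <= vsum r (indicator J))%Z ->
  (exists j, j < r /\ J j = true) ->
  finite_pred (fun s : sec F (basic_open G t) => exists g, s = res F (@incl_topen (basic_open G t)) g).
Proof.
  induction n as [n IHn] using lt_wf_ind. intros J t Ht Hn HJ.
  assert (Hind : forall K, nonneg (indicator K)).
  { intros K i. unfold indicator. destruct (K i); lia. }
  assert (HU : forall i, i < r -> J i = true -> forall x, oset (basic_open G t) x -> ~ pid x (gen i)).
  { intros i Hi EJ x Hx Hxi. apply Hx. rewrite Ht. apply pid_mon_gen with i; auto.
    unfold indicator. rewrite EJ. lia. }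
  assert (HV : forall f, incl (basic_open G (t · f)) (basic_open G t)).
  { intros f x Hx Hxt. apply Hx. apply pid_mmul. left. exact Hxt. }
  assert (Htp : part G (Z.to_nat (vsum r (indicator J))) t).
  { rewrite Ht. pose proof (@vsum_nonneg r (indicator J) (fun i _ => Hind J i)).
    apply part_mon; auto; lia. }
  assert (Hidx : forall i, In i (filter (fun i => negb (J i)) (seq 0 r)) <-> i < r /\ J i = false).
  { intros i. rewrite filter_In, in_seq, Bool.negb_true_iff. intuition lia. }
  assert (Hza := @vact_vaction r J (basic_open G t) Hg1 HU).
  (* A cell consists of sections with the same restriction to [U_(J + i)] for every [i] outside [J];
     the induction hypothesis leaves finitely many cells. *)
  apply finite_pred_refine with (idx := filter (fun i => negb (J i)) (seq 0 r))
    (Q := fun i P => forall s s', P s -> P s' -> res F (HV (gen i)) s = res F (HV (gen i)) s').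
  - intros i Hi. apply Hidx in Hi. destruct Hi as [Hi EJ].
    set (J' := fun l => if Nat.eq_dec l i then true else J l).
    assert (EJ' : indicator J' = vadd (indicator J) (vunit i)).
    { vext. unfold indicator, J', vunit. destruct (Nat.eq_dec x i) as [->|]; [rewrite EJ|]; lia. }
    assert (Hs : vsum r (indicator J') = (vsum r (indicator J) + 1)%Z).
    { rewrite EJ', vsum_add, vsum_unit. destruct (lt_dec i r); lia. }
    (* As [J] misses [i], it has at most [r - 1] elements below [r]; hence [n] is positive and
       [n - 1] is smaller. *)
    pose proof (@vsum_indicator_le r J').
    destruct (IHn (n - 1) ltac:(lia) J' (t · gen i)) as [l Hl].
    + rewrite EJ', mon_vadd, mon_unit, Ht; auto.
      intros l. unfold vunit. destruct (Nat.eq_dec l i); lia.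
    + lia.
    + exists i. split; [exact Hi|]. unfold J'. destruct (Nat.eq_dec i i); congruence.
    + exists (map (fun c s => res F (HV (gen i)) s = c) l). split.
      * intros P HP s s' Hs1 Hs2. apply in_map_iff in HP. destruct HP as [c [<- _]]. congruence.
      * intros s [g Hg]. exists (fun s' => res F (HV (gen i)) s' = res F (HV (gen i)) s).
        split; [|reflexivity].
        apply (in_map (fun c s' => res F (HV (gen i)) s' = c)).
        apply Hl. exists g. rewrite Hg. apply res_comp.
  - intros sg Hsg. apply finite_of_representations with (1 := Hza); [exact HJ | |].
    + intros j Hj EJ. destruct (chart_generators Hcoh (Hg1 j Hj)) as [L HL].
      assert (Hinc : incl (basic_open G t) (basic_open G (gen j))).
      { intros x Hx. apply HU; assumption. }
      (* The base section is added for the case that the numerator [b] is zero. *)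
      exists (spt F (basic_open G t) :: map (res F Hinc) L).
      intros s [[g Hs] _].
      (* Here globality enters: [s] extends to [D_+(a_j)] for every [j] in [J], and is described
         there by the generators of that chart. *)
      destruct (HL (res F (@incl_topen (basic_open G (gen j))) g)) as [m [b [k [Hm [Hb Eg]]]]].
      assert (Hk : part G k (mpow (gen j) k)).
      { rewrite <- (Nat.mul_1_r k) at 1. apply part_mpow. auto. }
      assert (Es : s = act F (basic_open G t) b (mpow (gen j) k) (res F Hinc m)).
      { rewrite Hs, <- (res_comp (o := F)) with (H1 := @incl_topen (basic_open G (gen j))) (H2 := Hinc).
        rewrite Eg. apply act_res. split; [|exists k; split; assumption].
        intros x Hx H. apply Hx. apply pid_mpow in H. exact H. }
      assert (Hkd : denom (basic_open G t) (mpow (gen j) k)).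
      { intros x Hx H. apply pid_mpow in H. apply (HU j Hj EJ x Hx H). }
      destruct (homogeneous_mon H0 Hfg Hg2 Hb) as [Eb|[u [Hu [Hur [Hd Eb]]]]].
      * exists (spt F (basic_open G t)), (fun _ => 0%Z). split; [left; reflexivity|].
        split; [|split; [|split]].
        -- apply vsum_zero.
        -- reflexivity.
        -- lia.
        -- rewrite (vact0 Hza), Es, Eb. apply act_zero. split; [exact Hkd|].
           exists k. split; [apply part_zero | exact Hk].
      * exists (res F Hinc m), (vadd u (vscale (-1) (vscale (Z.of_nat k) (vunit j)))).
        split; [right; apply in_map; exact Hm|]. split; [|split; [|split]].
        -- rewrite vsum_add, !vsum_scale, vsum_unit. destruct (lt_dec j r); lia.
        -- intros i Hi. unfold vadd, vscale, vunit. rewrite (Hur i Hi).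
           destruct (Nat.eq_dec i j); lia.
        -- intros i Hi Hij. specialize (Hu i). unfold vadd, vscale, vunit.
           destruct (Nat.eq_dec i j); lia.
        -- rewrite Es, Eb, <- (mon_scale_unit k Hj). apply act_mon with (J := J); auto.
           ++ intros i. unfold vscale, vunit. destruct (Nat.eq_dec i j); lia.
           ++ rewrite vsum_scale, vsum_unit. destruct (lt_dec j r); lia.
           ++ intros i Hi. split; [auto|]. unfold vscale, vunit. destruct (Nat.eq_dec i j); lia.
           ++ intros i Hi EJi. unfold vscale, vunit. destruct (Nat.eq_dec i j) as [->|]; [congruence | lia].
    + intros s s' [_ Hs] [_ Hs'] i j Hi Hj EJi EJj.
      assert (Hin : In i (filter (fun i => negb (J i)) (seq 0 r))) by (apply Hidx; auto).
      assert (Hinc : incl (basic_open G t) (basic_open G (gen j))).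
      { intros x Hx. apply HU; assumption. }
      destruct (@agree_power A G F Hcoh (gen j) t (gen i) _ s s' (HV (gen i)) (Hg1 j Hj) Htp (Hg1 i Hi)
        Hinc (Hsg i Hin s s' (Hs i Hin) (Hs' i Hin))) as [k Hk].
      exists k.
      assert (Eact : forall z, vact r (basic_open G t) (vscale (Z.of_nat k) (vdiff i j)) z
         = act F (basic_open G t) (mpow (gen i) k) (mpow (gen j) k) z).
      { intros z. rewrite <- (mon_scale_unit k Hi), <- (mon_scale_unit k Hj).
        rewrite act_mon with (J := J); auto.
        - f_equal. vext.
        - intros l. unfold vscale, vunit. destruct (Nat.eq_dec l i); lia.
        - intros l. unfold vscale, vunit. destruct (Nat.eq_dec l j); lia.
        - rewrite !vsum_scale, !vsum_unit. destruct (lt_dec j r), (lt_dec i r); lia.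
        - intros l Hl. unfold vscale, vunit. destruct (Nat.eq_dec l j), (Nat.eq_dec l i); lia.
        - intros l Hl EJl. unfold vscale, vunit. destruct (Nat.eq_dec l j) as [->|]; [congruence | lia]. }
      rewrite !Eact. exact Hk.
Qed.

(** A homogeneous element of positive degree outside the prime is a monomial with some positive
    exponent, and the corresponding generator is outside the prime as well. *)
Lemma mproj_covered r (H0 : A0_is_01 G) (Hfg : fin_gen_by_A1 G)
  (Hg2 : forall a, part G 1 a -> exists i, i < r /\ gen i = a) (x : MProj G) :
  exists i, i < r /\ ~ pid x (gen i).
Proof.
  destruct (proj2_sig x) as [_ [k [a [Hk [Ha Hxa]]]]].
  destruct (homogeneous_mon H0 Hfg Hg2 Ha) as [->|[u [Hu [Hur [Hd Ea]]]]];
    [exfalso; apply Hxa; apply pid_zero|].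
  assert (Hex : exists i, i < r /\ (1 <= u i)%Z).
  { apply NNPP. intros Hno.
    assert (E : forall i, u i = 0%Z).
    { intros i. destruct (le_lt_dec r i) as [Hi|Hi]; [auto|]. specialize (Hu i).
      destruct (Z_le_gt_dec 1 (u i)) as [Hl|Hl]; [|lia]. exfalso. apply Hno. exists i. auto. }
    apply functional_extensionality in E. rewrite E, vsum_zero in Hd. lia. }
  destruct Hex as [i [Hi Hui]]. exists i. split; [exact Hi|]. intros Hxi. apply Hxa.
  change (pid x a). rewrite Ea. apply pid_mon_gen with i; auto. lia.
Qed.

End Monomials.

Lemma filter_classical (T : Type) (P : T -> Prop) (l : list T) :
  exists l', forall a, In a l' <-> In a l /\ P a.
Proof.
  induction l as [|b l [l' Hl']]; [exists []; simpl; tauto|].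
  destruct (classic (P b)) as [Hb|Hb].
  - exists (b :: l'). intros a. simpl. rewrite Hl'. split; [|tauto].
    intros [<-|H]; tauto.
  - exists l'. intros a. rewrite Hl'. simpl. split; [tauto|]. intros [[<-|H] Ha]; tauto.
Qed.

Theorem mainTheorem4 (A : Monoid) (G : Grading A)
  (H0 : A0_is_01 G) (Hfg : fin_gen_by_A1 G)
  (F : OSheaf G) (Hcoh : coherent F) :
  finite_type (sec F (topen G)).
Proof.
  (* The list given for [A_1] may contain elements of other degrees, which are discarded first. *)
  destruct (proj1 Hfg) as [l0 Hl0]. destruct (filter_classical (part G 1) l0) as [l Hl].
  set (gen := fun i => nth i l (mzero A)). set (r := length l).
  assert (Hg1 : forall i, i < r -> part G 1 (gen i)).
  { intros i Hi. apply (proj1 (Hl (gen i))). apply nth_In. exact Hi. }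
  assert (Hg2 : forall a, part G 1 a -> exists i, i < r /\ gen i = a).
  { intros a Ha. apply In_nth. apply Hl. auto. }
  cut (finite_pred (fun _ : sec F (topen G) => True)).
  { intros [L HL]. exists L. intros s. apply HL. exact I. }
  apply finite_pred_refine with (idx := seq 0 r) (Q := fun i P => forall s s', P s -> P s' ->
      res F (@incl_topen A G (basic_open G (gen i))) s = res F (@incl_topen A G (basic_open G (gen i))) s').
  - intros i Hi. apply in_seq in Hi.
    (* The opens [D_+(a_i)] are the [U_J] for singletons [J]; taking [n = r] makes the size
       condition trivial. *)
    set (J := fun l => if Nat.eq_dec l i then true else false).
    destruct (@image_finite A G F gen r H0 Hfg Hcoh Hg1 Hg2 r J (gen i)) as [L HL].
    + rewrite <- mon_unit with (r := r) by lia. f_equal. vext. unfold indicator, J, vunit.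
      destruct (Nat.eq_dec x i); reflexivity.
    + rewrite Z.sub_diag. apply vsum_nonneg. intros j _. unfold indicator. destruct (J j); lia.
    + exists i. split; [lia|]. unfold J. destruct (Nat.eq_dec i i); congruence.
    + exists (map (fun c s => res F (@incl_topen A G (basic_open G (gen i))) s = c) L). split.
      * intros P HP s s' Hs Hs'. apply in_map_iff in HP. destruct HP as [c [<- _]]. congruence.
      * intros s _. exists (fun s' => res F (@incl_topen A G (basic_open G (gen i))) s'
            = res F (@incl_topen A G (basic_open G (gen i))) s).
        split; [|reflexivity].
        apply (in_map (fun c s' => res F (@incl_topen A G (basic_open G (gen i))) s' = c)).
        apply HL. exists s. reflexivity.
  - intros sg Hsg.
    (* The sections in a cell have the same restriction to every [D_+(a_i)]. These opens cover [X],
       so by locality a cell has at most one element. *)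
    destruct (classic (exists s0, forall i, In i (seq 0 r) -> sg i s0)) as [[s0 Hs0]|Hno];
      [|exists []; intros s [_ Hs]; apply Hno; exists s; exact Hs].
    exists [s0]. intros s [_ Hs]. left.
    apply (@sh_locality A G F (topen G) {i | i < r} (fun i => basic_open G (gen (proj1_sig i)))
             (fun i => @incl_topen A G (basic_open G (gen (proj1_sig i))))).
    + intros x _. destruct (@mproj_covered A G gen r H0 Hfg Hg2 x) as [i [Hi Hx]].
      exists (exist _ i Hi). exact Hx.
    + intros [i Hi]. simpl. assert (Hin : In i (seq 0 r)) by (apply in_seq; lia).
      apply (Hsg i Hin); auto.
Qed.
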